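(* Let $s,t,p\ge 1$, $A,B\in GL(n)$, $Q\in\mathcal{P}(n)$, and put $c_1=\max\{\lambda_1^{1/t}(AQ^{-1}A^* ),\;\lambda_1^{1/p}(BQ^{-1}B^* )\}$. Suppose there exists $k>0$ such that $k^{-t}+k^{-p}<1$ and $$\lambda_1(c_1^sQ^{-1})\le(1-k^{-t}-k^{-p})k^{-s}.$$ Then $kc_1I\le Q^{1/s}$ and the equation $X^s+A^*X^{-t}A+B^*X^{-p}B=Q$ has a Hermitian positive definite solution in $[kc_1I,Q^{1/s}]$. Furthermore, if $$\frac1s(kc_1)^{1-s}\Big[\frac{t}{(kc_1)^{t+1}}\|A\|^2+\frac{p}{(kc_1)^{p+1}}\|B\|^2\Big]<1,$$ then this solution is the unique solution in $[kc_1I,Q^{1/s}]$.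
   Context: $GL(n)$: $n\times n$ complex nonsingular matrices; $\mathcal{P}(n)$: $n\times n$ Hermitian positive definite matrices. For Hermitian $M$, $\lambda_1(M)$ is its largest eigenvalue. $\|\cdot\|$ is the spectral norm. For Hermitian $P,R$, $P\le R$ means $R-P$ is positive semidefinite, and $[P,R]=\{X \text{ Hermitian}: P\le X\le R\}$. Real powers of positive definite matrices are defined by functional calculus. *)

(* Defs.v *)
From Stdlib Require Import Reals List ClassicalEpsilon.
Open Scope R_scope.

Record C := mkC { Re : R ; Im : R }.
Definition C0 : C := mkC 0 0.
Definition C1 : C := mkC 1 0.
Definition RtoC (r : R) : C := mkC r 0.
Definition Cadd (x y : C) : C := mkC (Re x + Re y) (Im x + Im y).
Definition Copp (x : C) : C := mkC (- Re x) (- Im x).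
Definition Cmul (x y : C) : C :=
  mkC (Re x * Re y - Im x * Im y) (Re x * Im y + Im x * Re y).
Definition Cconj (x : C) : C := mkC (Re x) (- Im x).
Definition Csum (n : nat) (f : nat -> C) : C :=
  fold_right Cadd C0 (map f (seq 0 n)).

(** Vectors and matrices (only indices < n are meaningful) *)
Definition Vec := nat -> C.
Definition Mat := nat -> nat -> C.

Definition meq (n : nat) (A B : Mat) : Prop :=
  forall i j, (i < n)%nat -> (j < n)%nat -> A i j = B i j.
Definition vnonzero (n : nat) (v : Vec) : Prop :=
  exists i, (i < n)%nat /\ v i <> C0.

Definition madd (A B : Mat) : Mat := fun i j => Cadd (A i j) (B i j).
Definition msub (A B : Mat) : Mat := fun i j => Cadd (A i j) (Copp (B i j)).
Definition mscale (r : R) (A : Mat) : Mat := fun i j => Cmul (RtoC r) (A i j).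
Definition mmul (n : nat) (A B : Mat) : Mat :=
  fun i j => Csum n (fun k => Cmul (A i k) (B k j)).
Definition madj (A : Mat) : Mat := fun i j => Cconj (A j i).
Definition mid : Mat := fun i j => if Nat.eqb i j then C1 else C0.
Definition mdiag (d : nat -> R) : Mat :=
  fun i j => if Nat.eqb i j then RtoC (d i) else C0.
Definition mvec (n : nat) (A : Mat) (v : Vec) : Vec :=
  fun i => Csum n (fun k => Cmul (A i k) (v k)).
Definition inner (n : nat) (u v : Vec) : C :=
  Csum n (fun k => Cmul (Cconj (u k)) (v k)).
Definition vnorm (n : nat) (v : Vec) : R := sqrt (Re (inner n v v)).

Definition invertible (n : nat) (A : Mat) : Prop :=
  exists B, meq n (mmul n A B) mid /\ meq n (mmul n B A) mid.
Definition minv (n : nat) (A : Mat) : Mat :=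
  epsilon (inhabits mid)
    (fun B => meq n (mmul n A B) mid /\ meq n (mmul n B A) mid).

Definition hermitian (n : nat) (A : Mat) : Prop := meq n (madj A) A.
Definition psd (n : nat) (A : Mat) : Prop :=
  hermitian n A /\ forall v : Vec, 0 <= Re (inner n v (mvec n A v)).
Definition pd (n : nat) (A : Mat) : Prop :=
  hermitian n A /\
  forall v : Vec, vnonzero n v -> 0 < Re (inner n v (mvec n A v)).
Definition mle (n : nat) (P Q : Mat) : Prop :=
  hermitian n P /\ hermitian n Q /\ psd n (msub Q P).
Definition in_interval (n : nat) (P Q X : Mat) : Prop :=
  hermitian n X /\ mle n P X /\ mle n X Q.

Definition unitary (n : nat) (U : Mat) : Prop := meq n (mmul n (madj U) U) mid.

Definition is_rpow (n : nat) (Q : Mat) (r : R) (Y : Mat) : Prop :=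
  exists (U : Mat) (d : nat -> R),
    unitary n U /\ (forall i, (i < n)%nat -> 0 < d i) /\
    meq n Q (mmul n U (mmul n (mdiag d) (madj U))) /\
    meq n Y (mmul n U (mmul n (mdiag (fun i => Rpower (d i) r)) (madj U))).
Definition mpow (n : nat) (Q : Mat) (r : R) : Mat :=
  epsilon (inhabits mid) (fun Y => is_rpow n Q r Y).

Definition is_eigenvalue (n : nat) (M : Mat) (l : R) : Prop :=
  exists v : Vec, vnonzero n v /\
    forall i, (i < n)%nat -> mvec n M v i = Cmul (RtoC l) (v i).
Definition lambda1 (n : nat) (M : Mat) : R :=
  epsilon (inhabits 0)
    (fun l => is_eigenvalue n M l /\ forall m, is_eigenvalue n M m -> m <= l).

Definition specnorm (n : nat) (A : Mat) : R :=
  epsilon (inhabits 0)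
    (fun m => is_lub (fun r => exists v : Vec, vnorm n v = 1 /\
                                  r = vnorm n (mvec n A v)) m).

Definition is_solution (n : nat) (s t p : R) (A B Q X : Mat) : Prop :=
  meq n (madd (mpow n X s)
          (madd (mmul n (madj A) (mmul n (mpow n X (- t)) A))
                (mmul n (madj B) (mmul n (mpow n X (- p)) B)))) Q.

(* Main.v *)
(* Put c = k c_1. The choice of c_1 gives A^* A <= c_1^t Q and B^* B <= c_1^p Q, hence
   c^s I + c^(-t) A^* A + c^(-p) B^* B <= Q, so that the right-hand side of
   X = (Q - A^* X^(-t) A - B^* X^(-p) B)^(1/s) maps the Hermitian matrices X >= c I into
   themselves, and below Q^(1/s) by the Loewner-Heinz inequality. An L-Lipschitz function on the
   spectra is L-Lipschitz in the Frobenius norm as a function of Hermitian matrices (compare the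
   two matrices entry by entry between their eigenbases). So this map is Lipschitz, and so is the
   retraction of the space of matrices onto [c I, b I] which clamps the spectrum of the Hermitian
   part: a fixed point exists by Brouwer's theorem, itself derived from Scarf's lemma on dominant
   sets. Under the last condition the map is a Frobenius contraction, which gives uniqueness. *)
From HB Require Import structures.
From Stdlib Require Import Reals ClassicalEpsilon.
Require Import Defs.
From mathcomp Require Import all_classical.
From mathcomp Require Import all_boot all_order all_algebra spectral sesquilinear complex.
From mathcomp Require Import reals topology normedtype derive sequences exp.
From mathcomp Require Import Rstruct Rstruct_topology ring lra.
Set Implicit Arguments.
Unset Strict Implicit.
Unset Printing Implicit Defensive.
Import Order.TTheory GRing.Theory Num.Theory Normc numFieldNormedType.Exports.
Close Scope R_scope.

(** * Dominant sets and Scarf's lemma *)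

Section ImsetRemove.
Variables (A B : finType) (f : A -> B).
Implicit Types (s : {set A}) (x y : A).

Lemma imset_setD1P s x : x \in s ->
  reflect (exists2 y, y \in s :\ x & f y = f x) (f @: (s :\ x) == f @: s).
Proof.
move=> xs; apply: (iffP eqP) => [E|[y ys fyx]].
  have /imsetP[y ys fxy] : f x \in f @: (s :\ x) by rewrite E imset_f.
  by exists y.
rewrite -{2}(setD1K xs) imsetU1; apply/esym/setUidPr.
by rewrite sub1set -fyx imset_f.
Qed.

Lemma card_imset_setD1 s : #|s| = #|f @: s|.+1 ->
  #|[set x in s | f @: (s :\ x) == f @: s]| = 2.
Proof.
move=> cardE; have /dinjectivePn[x xs [y]] : ~~ dinjectiveb f s.
  by apply/negP => /dinjectiveP/imset_injP; rewrite cardE ltn_eqF.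
rewrite inE => /andP[yx ys] fxy.
have imx : f @: (s :\ x) = f @: s.
  by apply/eqP/imset_setD1P => //; exists y; rewrite // !inE yx.
have injx : {in s :\ x &, injective f}.
  by apply/imset_injP; rewrite imx -eqSS -cardE (cardsD1 x s) xs.
suff -> : [set z in s | f @: (s :\ z) == f @: s] = [set x; y].
  by rewrite cards2 eq_sym yx.
apply/setP => z; rewrite !inE; apply/andP/orP => [[zs]|[]/eqP->].
- case/(imset_setD1P zs) => w; rewrite !inE => /andP[wz ws] fwz.
  have [->|zx] := eqVneq z x; [by left | right; apply/eqP].
  have [wx|wx] := eqVneq w x; first by apply: injx; rewrite ?inE ?zx ?yx // -fwz wx.
  by move: wz; rewrite (injx w z) ?eqxx // !inE ?zx ?wx.
- by split=> //; apply/eqP.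
- by split=> //; apply/(imset_setD1P ys); exists x; rewrite // !inE eq_sym yx.
Qed.

End ImsetRemove.

Lemma exchange_setU1_setD1 (X : finType) (F : {set X} -> X -> nat) :
  \sum_(s : {set X}) \sum_(x | x \notin s) F s x =
  \sum_(s : {set X}) \sum_(x in s) F (s :\ x) x.
Proof.
rewrite (exchange_big_dep predT) //= [RHS](exchange_big_dep predT) //=.
apply: eq_bigr => x _; rewrite (reindex_onto (fun s => s :\ x) (fun s => x |: s)) /=.
  apply: eq_bigl => s; rewrite !inE eqxx /=; apply/eqP/idP => [<-|xs].
    exact: setU11.
  exact: setD1K.
by move=> s xs; rewrite setU1K.
Qed.

Lemma odd_sum_ex (J : finType) (F : J -> nat) :
  odd (\sum_j F j) -> exists j, odd (F j).
Proof.
move=> oF; apply/existsP; apply: contraLR oF => /existsPn eF.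
by rewrite (big_morph odd oddD (erefl _)) big1 // => j _; apply/negbTE/eF.
Qed.

Section Dominance.
Variables (I X : finType) (rk : I -> X -> nat).
Hypothesis rk_inj : forall i, injective (rk i).
Implicit Types (i j k : I) (x y z : X) (s : {set X}).

Definition lowest i y s := [forall x in s, rk i y <= rk i x].

Definition dominant s := [forall y, exists i, lowest i y s].

Lemma lowestP i y s : reflect {in s, forall x, rk i y <= rk i x} (lowest i y s).
Proof. exact: forall_inP. Qed.

Lemma dominantP s : reflect (forall y, exists i, lowest i y s) (dominant s).
Proof. by apply: (iffP forallP) => h y; apply/existsP/h. Qed.

Lemma lowestU1 i y x s : lowest i y (x |: s) = (rk i y <= rk i x) && lowest i y s.
Proof.
apply/lowestP/andP => [h|[yx /lowestP h] z /setU1P[->//|]]; last exact: h.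
split; first exact/h/setU11.
by apply/lowestP => z zs; apply/h/setU1r.
Qed.

Lemma sub_dominant s s' : s' \subset s -> dominant s -> dominant s'.
Proof.
move=> /subsetP ss /dominantP h; apply/dominantP => y; have [i /lowestP l] := h y.
by exists i; apply/lowestP => x /ss; apply: l.
Qed.

Lemma lowest_uniq i x y s : x \in s -> y \in s -> lowest i x s -> lowest i y s -> x = y.
Proof.
move=> xs ys /lowestP lx /lowestP ly; apply: (@rk_inj i).
by apply/eqP; rewrite eqn_leq lx // ly.
Qed.

Lemma dominant_bottom s : dominant s -> s != set0 ->
  exists2 b : I -> X, forall i, b i \in s /\ lowest i (b i) s & b @: setT = s.
Proof.
move=> /dominantP sd /set0Pn[z0 z0s]; pose b i := [arg min_(z < z0 in s) rk i z].
have bP i : b i \in s /\ lowest i (b i) s.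
  by rewrite /b; case: arg_minnP => // z zs zmin; split=> //; apply/lowestP.
exists b => //; apply/setP => x; apply/imsetP/idP => [[i _ ->]|xs].
  by have [] := bP i.
have [i li] := sd x; exists i => //; have [bs bl] := bP i.
exact: lowest_uniq xs bs li bl.
Qed.

(* A dominant set with one element less than there are orders is a door; the elements that
   complete it to a dominant set are the rooms onto which it opens. *)
Definition completions s := [set x | (x \notin s) && dominant (x |: s)].

Section Facet.
Variables (s : {set X}) (b : I -> X).
Hypotheses (sd : dominant s) (cardI : #|I| = #|s|.+1).
Hypotheses (bP : forall i, b i \in s /\ lowest i (b i) s) (b_im : b @: setT = s).

Let above i := [set y | [forall (k | k != i), ~~ lowest k y s]].

Hypothesis above_neq0 : forall i, above i != set0.

(* The two orders that have the same lowest element in [s]: the completions of [s] are the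
   peaks over these two orders. *)
Let twins := [set i in setT | b @: (setT :\ i) == b @: setT].

Let aboveP i y : reflect (forall k, k != i -> ~~ lowest k y s) (y \in above i).
Proof. rewrite inE; exact: forall_inP. Qed.

Let above_lowest i y : y \in above i -> lowest i y s.
Proof.
move/aboveP=> yi; have [k lk] := dominantP _ sd y.
by have [<-|/yi] := eqVneq k i; rewrite ?lk.
Qed.

Let above_disjoint i j y : y \in above i -> y \in above j -> i = j.
Proof.
by move=> /above_lowest yi /aboveP yj; apply/eqP; apply: contraTT yi => /yj.
Qed.

Let peak i := [arg max_(y > xchoose (set0Pn _ (above_neq0 i)) in above i) rk i y].

Let peakP i : peak i \in above i /\ {in above i, forall x, rk i x <= rk i (peak i)}.
Proof. by rewrite /peak; case: arg_maxnP => //; apply: xchooseP. Qed.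

Let peak_above i : peak i \in above i. Proof. by case: (peakP i). Qed.

Let peak_max i x : x \in above i -> rk i x <= rk i (peak i).
Proof. by case: (peakP i) => _; apply. Qed.

Let peak_completes i : i \in twins -> peak i \in completions s.
Proof.
rewrite !inE b_im /= => /eqP bi; have /aboveP pi := peak_above i.
apply/andP; split.
  apply/negP; rewrite -{1}bi => /imsetP[k]; rewrite !inE andbT => /pi + E.
  by rewrite E; case: (bP k) => _ ->.
apply/dominantP => y; have [yi|] := boolP (y \in above i).
  by exists i; rewrite lowestU1 peak_max ?above_lowest.
rewrite inE negb_forall_in => /exists_inP[k ki]; rewrite negbK => /[dup] lk /lowestP yk.
exists k; rewrite lowestU1 lk andbT; have := pi k ki.
rewrite negb_forall_in => /exists_inP[z zs]; rewrite -ltnNge => /ltnW.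
exact/leq_trans/yk.
Qed.

Let completion_peak x : x \in completions s -> exists2 i, i \in twins & x = peak i.
Proof.
rewrite inE => /andP[xs xd].
have xs0 : x |: s != set0 by apply/set0Pn; exists x; apply: setU11.
have [c cP c_im] := dominant_bottom xd xs0.
have c_inj : {in setT &, injective c}.
  by apply/imset_injP; rewrite c_im cardsU1 xs cardsT cardI.
have /imsetP[i _ xi] : x \in c @: setT by rewrite c_im setU11.
have cs k : k != i -> c k \in s.
  move=> ki; have [/setU1P[ckx|//] _] := cP k.
  by move: ki; rewrite (c_inj k i) ?inE ?eqxx // ckx.
have cl k : lowest k (c k) s by have [_] := cP k; rewrite lowestU1 => /andP[].
have cb k : k != i -> c k = b k.
  by move=> ki; have [bs bl] := bP k; apply: lowest_uniq (cs k ki) bs (cl k) bl.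
exists i.
  rewrite !inE b_im /= eqEsubset; apply/andP; split; apply/subsetP => z.
    by case/imsetP => k _ ->; case: (bP k).
  move=> zs; have /imsetP[k _ zk] : z \in c @: setT by rewrite c_im setU1r.
  have ki : k != i by apply: contraNneq xs => ki; rewrite xi -ki -zk.
  by rewrite zk cb // imset_f // !inE ki.
have xa : x \in above i.
  apply/aboveP => k ki; apply/negP => /lowestP/(_ _ (cs k ki)) xc.
  have [_] := cP k; rewrite lowestU1 => /andP[cx _].
  have /rk_inj E : rk k x = rk k (c k) by apply/eqP; rewrite eqn_leq xc.
  by move: xs; rewrite E cs.
apply: (@rk_inj i); apply/eqP; rewrite eqn_leq peak_max //=.
have [k] := dominantP _ xd (peak i); rewrite lowestU1 => /andP[px lk].
have [ki|ki] := eqVneq k i; first by move: px; rewrite ki.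
by have /aboveP/(_ k ki) := peak_above i; rewrite lk.
Qed.

Lemma card_completions_of_bottom : #|completions s| = 2.
Proof.
have <- : #|twins| = 2 by apply: card_imset_setD1; rewrite b_im cardsT.
suff -> : completions s = peak @: twins.
  apply: card_in_imset => i j _ _ E; apply: above_disjoint (peak_above i) _.
  by rewrite E peak_above.
apply/setP => x; apply/idP/imsetP => [/completion_peak//|[i it ->]].
exact: peak_completes.
Qed.

End Facet.

Lemma card_completions s : dominant s -> s != set0 -> #|I| = #|s|.+1 ->
  (forall i, exists y, forall k, k != i -> ~~ lowest k y s) -> #|completions s| = 2.
Proof.
move=> sd s0 cardI above; have [b bP b_im] := dominant_bottom sd s0.
apply: card_completions_of_bottom bP b_im _ => // i; have [y yi] := above i.
by apply/set0Pn; exists y; rewrite inE; apply/forall_inP.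
Qed.

Section Labelling.
Variables (slack : I -> X) (label : X -> I).

Hypothesis slack_lowest : forall i x, x != slack i -> rk i (slack i) < rk i x.
Hypothesis below_slack : forall i k x,
  x \notin codom slack -> k != i -> rk k x < rk k (slack i).
Hypothesis label_slack : cancel slack label.
Hypothesis inner_ex : exists x, x \notin codom slack.

Section Doors.
Variable i0 : I.

Let outer := slack @: [set~ i0].

Let door s := [&& dominant s, #|I| == #|s|.+1 & label @: s == [set~ i0]].

Let slackP x : reflect (exists i, x = slack i) (x \in codom slack).
Proof. by apply: (iffP codomP) => -[i ->]; exists i. Qed.

Let lowest_slack i s : lowest i (slack i) s.
Proof.
by apply/lowestP => x _; have [->//|/slack_lowest/ltnW] := eqVneq x (slack i).
Qed.

Let lowest_outer y : y \notin codom slack -> lowest i0 y outer.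
Proof.
move=> yi; apply/lowestP => _ /imsetP[k + ->]; rewrite !inE eq_sym => ki.
exact/ltnW/below_slack.
Qed.

Let outer_door : door outer.
Proof.
rewrite /door card_imset ?cardsC1; last exact: can_inj label_slack.
rewrite -imset_comp (eq_imset _ label_slack) imset_id eqxx andbT.
rewrite prednK ?eqxx ?andbT; last by apply/card_gt0P; exists i0.
apply/dominantP => y; have [/slackP[i ->]|yi] := boolP (y \in codom slack).
  by exists i; apply: lowest_slack.
by exists i0; apply: lowest_outer.
Qed.

Let card_outer_completions : #|completions outer| = 1.
Proof.
have [x0 x0i] := inner_ex.
have [t /= ti tmax] := @arg_maxnP _ x0 [pred x | x \notin codom slack] (rk i0) x0i.
suff -> : completions outer = [set t] by rewrite cards1.
apply/setP => x; rewrite !inE; apply/andP/eqP => [[xo /dominantP xd]|->].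
  have inner_le y : y \notin codom slack -> rk i0 y <= rk i0 x.
    move=> yi; have [k] := xd y; rewrite lowestU1 => /andP[yx /lowestP yo].
    have [<-//|ki0] := eqVneq k i0; have := yo (slack k).
    rewrite imset_f ?inE // => /(_ isT); rewrite leqNgt slack_lowest //.
    by apply: contraNneq yi => ->; apply: codom_f.
  have xi : x \notin codom slack.
    apply/negP => /slackP[i xE]; move: xo; rewrite xE.
    have [ii0|ii0] := eqVneq i i0; last by rewrite imset_f ?inE.
    have := inner_le t ti; rewrite xE ii0 leqNgt slack_lowest //.
    by apply: contraNneq ti => ->; apply: codom_f.
  by apply: (@rk_inj i0); apply/eqP; rewrite eqn_leq inner_le // tmax.
split; first by apply: contra ti => /imsetP[i _ ->]; apply: codom_f.
apply/dominantP => y; have [/slackP[i ->]|yi] := boolP (y \in codom slack).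
  by exists i; apply: lowest_slack.
by exists i0; rewrite lowestU1 tmax // lowest_outer.
Qed.

Let door_sub_slack s : door s -> s \subset codom slack -> s = outer.
Proof.
case/and3P=> _ _ /eqP ls /subsetP sslack; rewrite /outer -ls -imset_comp.
rewrite -[LHS]imset_id; apply: eq_in_imset => _ /sslack/slackP[i ->] /=.
by rewrite label_slack.
Qed.

Let odd_completions s : door s -> odd #|completions s| = (s == outer).
Proof.
move=> ds; have [->|sno] := eqVneq s outer; first by rewrite card_outer_completions.
have /subsetPn[z zs zi] : ~~ (s \subset codom slack).
  by apply: contra sno => /door_sub_slack->.
have s0 : s != set0 by apply/set0Pn; exists z.
case/and3P: ds => sd /eqP cs _; rewrite card_completions // => i.
exists (slack i) => k ki; apply/negP => /lowestP/(_ z zs).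
by rewrite leqNgt below_slack.
Qed.

Let full_of_odd s : #|s| = #|I| ->
  odd #|[set x in s | label @: (s :\ x) == [set~ i0]]| -> label @: s = setT.
Proof.
move=> cs /[dup] /odd_gt0/card_gt0P[x]; rewrite inE => /andP[xs /eqP lx].
have ls : label @: s = label x |: [set~ i0] by rewrite -lx -imsetU1 setD1K.
have [li|li] := eqVneq (label x) i0; first by rewrite ls li setUCr.
have {}ls : label @: s = [set~ i0] by rewrite ls; apply/setUidPr; rewrite sub1set !inE.
rewrite -ls card_imset_setD1 // ls cardsC1 cs prednK //.
by apply/card_gt0P; exists i0.
Qed.

Lemma fully_labelled_of_door : exists s, [/\ dominant s, #|s| = #|I| & label @: s = setT].
Proof.
pose F s x : nat := door s && dominant (x |: s).
have : odd (\sum_(s : {set X}) \sum_(x | x \notin s) F s x).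
  have sumE s : \sum_(x | x \notin s) F s x = door s * #|completions s|.
    rewrite -sum1dep_card big_distrr big_mkcondr /=; apply: eq_bigr => x _.
    by rewrite /F; case: (door s); case: (dominant _); rewrite ?mul0n.
  have even_door s : s != outer -> odd (\sum_(x | x \notin s) F s x) = false.
    by rewrite sumE; case: (boolP (door s)) => // ds /negbTE so; rewrite mul1n odd_completions.
  rewrite (big_morph odd oddD (erefl _)) (bigD1 outer) //= (eq_bigr _ even_door) big1_eq addbF.
  by rewrite sumE outer_door mul1n card_outer_completions.
rewrite exchange_setU1_setD1 => /odd_sum_ex[s os]; exists s.
have sE : {in s, forall x, F (s :\ x) x =
    [&& dominant s, #|s| == #|I| & label @: (s :\ x) == [set~ i0]] :> nat}.
  move=> x xs; rewrite /F setD1K // /door andbC; case: (boolP (dominant s)) => //= sd.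
  by rewrite (sub_dominant (subsetDl _ _) sd) [#|s|](cardsD1 x) xs eq_sym.
move: os; rewrite (eq_bigr _ sE).
case: (dominant s) => /=; last by rewrite big1.
have [cs|_] := eqVneq; last by rewrite big1.
rewrite -big_mkcondr sum1dep_card => /(full_of_odd cs).
by split.
Qed.

End Doors.

Theorem scarf_lemma : exists s, [/\ dominant s, #|s| = #|I| & label @: s = setT].
Proof. by have [x _] := inner_ex; apply: fully_labelled_of_door (label x). Qed.

End Labelling.
End Dominance.

(** * Labelled grids on a simplex *)

Lemma leq_of_leq_sum (I : finType) (f g : I -> nat) d : (forall i, f i <= g i) ->
  \sum_i g i <= \sum_i f i + d -> forall i, g i <= f i + d.
Proof.
move=> fg + i; rewrite (bigD1 i) //= [X in _ <= X + _](bigD1 i) //= addnAC => sum_le.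
rewrite -(leq_add2r (\sum_(k | k != i) f k)) (leq_trans _ sum_le) // leq_add2l.
exact: leq_sum.
Qed.

Section Grid.
Variables (m N : nat).

Definition grid := {g : {ffun 'I_m.+1 -> 'I_N.+1} | \sum_i g i == N :> nat}.

Implicit Types (g : grid) (u v : (grid + 'I_m.+1)%type) (i : 'I_m.+1).

Definition grid_coord g i : nat := sval g i.

Lemma sum_grid_coord g : \sum_i grid_coord g i = N.
Proof. by rewrite /grid_coord; case: g => g /= /eqP. Qed.

Lemma grid_of_fun (f : 'I_m.+1 -> nat) : \sum_i f i = N ->
  exists g, grid_coord g =1 f.
Proof.
move=> fN; have fle i : f i < N.+1 by rewrite ltnS -fN (bigD1 i) //= leq_addr.
have gP : \sum_i [ffun i => inord (f i) : 'I_N.+1] i == N :> nat.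
  by apply/eqP; rewrite -[RHS]fN; apply: eq_bigr => i _; rewrite ffunE inordK.
exists (exist (fun g : {ffun 'I_m.+1 -> 'I_N.+1} => \sum_i g i == N :> nat) _ gP) => i.
by rewrite /grid_coord /= ffunE inordK.
Qed.

Lemma grid_above (f : 'I_m.+1 -> nat) : \sum_i f i <= N ->
  exists g, forall i, f i <= grid_coord g i.
Proof.
move=> fN; have [|g gE] := @grid_of_fun (fun i => f i + (i == ord0) * (N - \sum_i f i)).
  by rewrite big_split /= -big_distrl /= -big_mkcond /= sum1_card card1 mul1n subnKC.
by exists g => i; rewrite gE leq_addr.
Qed.

(* The slack point [inr i] stands for a vertex far outside the simplex, below the face
   opposite to the vertex [i]; the coordinates of grid points are shifted to make room for it. *)
Definition height u i : nat :=
  match u with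
  | inl g => (grid_coord g i).+1
  | inr k => if k == i then 0 else N.+2
  end.

Definition height_rank i u : nat := height u i * #|{: grid + 'I_m.+1}| + enum_rank u.

Lemma height_rank_inj i : injective (height_rank i).
Proof.
move=> u v E; apply: enum_rank_inj; apply: val_inj => /=.
by move/(congr1 (modn^~ #|{: grid + 'I_m.+1}|)): E; rewrite !modnMDl !modn_small.
Qed.

Lemma ltn_height_rank i u v : height u i < height v i -> height_rank i u < height_rank i v.
Proof.
move=> uv; apply: (@leq_trans ((height u i).+1 * #|{: grid + 'I_m.+1}|)).
  by rewrite /height_rank mulSn addnC ltn_add2r.
by apply: leq_trans (leq_addr _ _); rewrite leq_mul2r uv orbT.
Qed.

Lemma leq_height i u v : height_rank i u <= height_rank i v -> height u i <= height v i.
Proof. by apply: contraTT; rewrite -!ltnNge; apply: ltn_height_rank. Qed.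

Definition in_cube (a : 'I_m.+1 -> nat) g := forall i, a i <= grid_coord g i <= a i + m.

Lemma slack_height_rank i u : u != inr i -> height_rank i (inr i) < height_rank i u.
Proof.
move=> ui; apply: ltn_height_rank; rewrite /= eqxx.
by case: u ui => //= k; case: (k =P i) => [->|//]; rewrite eqxx.
Qed.

Lemma height_rank_slack i k g : k != i -> height_rank k (inl g) < height_rank k (inr i).
Proof.
move=> ki; apply: ltn_height_rank; rewrite /= eq_sym (negbTE ki) ltnS -(sum_grid_coord g).
by rewrite (bigD1 k) //= leq_addr.
Qed.

(* [a i] is the least coordinate [i] of the dominant set given by Scarf's lemma. *)
Lemma dominant_in_cube (s : {set grid + 'I_m.+1}) : dominant height_rank s -> s != set0 ->
  exists2 a, (forall g, inl g \in s -> in_cube a g) & forall i, inr i \in s -> a i = 0.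
Proof.
move=> sd s0; have [b bP _] := dominant_bottom height_rank_inj sd s0.
pose a i := (height (b i) i).-1.
have a_le u i : u \in s -> height (b i) i <= height u i.
  by move=> us; have [_ /lowestP/(_ u us)/leq_height] := bP i.
have sum_a : N < \sum_i (a i).+1.
  rewrite ltnNge; apply/negP => /grid_above[g ga].
  have [i /lowestP gi] := dominantP _ _ sd (inl g).
  have [bs _] := bP i; have := leq_height (gi _ bs); rewrite leqNgt => /negP; apply.
  by apply: leq_ltn_trans (leqSpred _) _; rewrite ltnS; apply: ga.
exists a => [g gs i|i /a_le]; last by move/(_ i); rewrite /a /= eqxx; case: height.
have ag k : a k <= grid_coord g k.
  by have := a_le (inl g) k gs; rewrite /a; case: (height (b k) k).
rewrite ag /=; apply: leq_of_leq_sum ag _ i.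
rewrite sum_grid_coord -ltnS -addnS (leq_trans sum_a) //.
rewrite -[X in _ + X](card_ord m.+1) -sum1_card -big_split /=.
by apply: leq_sum => k _; rewrite addn1.
Qed.

Theorem sperner_grid (l : grid -> 'I_m.+1) : exists2 a,
  exists g, in_cube a g & forall i, a i = 0 \/ exists2 g, in_cube a g & l g = i.
Proof.
have [|g0 _] := @grid_above (fun=> 0); first by rewrite big1_eq.
pose label u := match u with inl g => l g | inr i => i end.
have not_slack g : inl g \notin codom (@inr grid 'I_m.+1).
  by apply/negP => /codomP[].
have [|||s [sd cs ls]] := scarf_lemma height_rank_inj slack_height_rank _ (_ : cancel inr label).
- by move=> i k [g _|j /negP[]]; [apply: height_rank_slack | apply: codom_f].
- by [].
- by exists (inl g0).
have s0 : s != set0 by rewrite -card_gt0 cs card_ord.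
have [a a_cube a_slack] := dominant_in_cube sd s0.
have lab i : exists2 u, u \in s & label u = i.
  by have /imsetP[u us ->] : i \in label @: s by [rewrite ls]; exists u.
exists a => [|i].
  have [i /lowestP gi] := dominantP _ _ sd (inl g0).
  have [[g gs _|k + /= ki]] := lab i; first by exists g; apply: a_cube.
  by move/gi/leq_height; rewrite /= ki eqxx.
have [[g gs /= gi|k ks /= ki]] := lab i; [right | left].
  by exists g => //; apply: a_cube.
by apply: a_slack; rewrite -ki.
Qed.

End Grid.

(** * Brouwer's fixed point theorem *)

Section StandardSimplex.
Local Open Scope ring_scope.
Local Open Scope classical_set_scope.
Variables (R : realType) (m : nat).
Implicit Types (c x y : 'rV[R]_m.+1) (G : 'rV[R]_m.+1 -> 'rV[R]_m.+1).

Definition stdsimplex : set 'rV[R]_m.+1 :=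
  [set x | (forall i, 0 <= x 0 i) /\ \sum_i x 0 i = 1].

Lemma stdsimplex_coord_le1 x i : stdsimplex x -> x 0 i <= 1.
Proof. by case=> x0 <-; rewrite (bigD1 i) //= lerDl sumr_ge0. Qed.

Lemma stdsimplex_coord_le x y : stdsimplex x -> stdsimplex y -> exists i, x 0 i <= y 0 i.
Proof.
move=> [_ x1] [_ y1]; apply/existsP; apply: contraT => /existsPn yx.
have : \sum_i y 0 i < \sum_i x 0 i.
  apply: ltr_sum => [|i _]; first by apply/hasP; exists ord0; rewrite ?mem_index_enum.
  by rewrite ltNge.
by rewrite x1 y1 ltxx.
Qed.

Lemma stdsimplex_coord_lt x y : stdsimplex x -> stdsimplex y -> x != y ->
  exists i, x 0 i < y 0 i.
Proof.
move=> [_ x1] [_ y1] xy; apply/existsP; apply: contraNT xy => /existsPn yx.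
have /psumr_eq0P xy0 : \sum_i (x 0 i - y 0 i) = 0 by rewrite sumrB x1 y1 subrr.
apply/eqP/rowP => i; apply/eqP; rewrite -subr_eq0 xy0 // => k _.
by rewrite subr_ge0 leNgt.
Qed.

Lemma compact_stdsimplex : compact stdsimplex.
Proof.
apply: bounded_closed_compact.
  exists 1; split=> // M M1 x xS; rewrite /Num.norm /= mx_normrE.
  apply/bigmax_leP; split=> [|[i j] _ /=]; first by apply: ltW; lra.
  rewrite (ord1 i) ger0_norm; last by case: xS.
  exact: le_trans (stdsimplex_coord_le1 j xS) (ltW M1).
have -> : stdsimplex = \bigcap_i [set x | 0 <= x 0 i] `&`
    [set x | \sum_i x 0 i = 1].
  apply/seteqP; split=> [x [x0 x1]|x [x0 x1]]; split=> // i; first by move=> _; apply: x0.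
  exact: x0 i I.
apply: closedI; first apply: closed_bigI => i _.
- apply: (@preimage_closed _ _ (fun x => x 0 i) [set r | 0 <= r]) => [x _|].
    exact: coord_continuous.
  exact: closed_ge.
- apply: (@preimage_closed _ _ (fun x => \sum_i x 0 i) [set r | r = 1]); last exact: closed_eq.
  move=> x _; apply: (@cvg_big _ _ _ _ _ _ _ (nbhs x)) => [|i _]; first exact: add_continuous.
  exact: coord_continuous.
Qed.

(* Sperner's lemma, read through the labelling of a point [y] by a coordinate that [G] does
   not decrease. *)
Definition almost_fixed G (e : R) x := forall i, x 0 i < e \/
  exists2 y, stdsimplex y & ball x e y /\ y 0 i <= G y 0 i.

Lemma almost_fixed_ex G (e : R) : (forall x, stdsimplex x -> stdsimplex (G x)) ->
  0 < e -> exists2 x, stdsimplex x & almost_fixed G e x.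
Proof.
move=> GS e0; pose N := (Num.truncn (m%:R / e)).+1.
have N0 : 0 < N%:R :> R by rewrite ltr0n.
have mN : m%:R / N%:R < e by rewrite ltr_pdivrMr // mulrC -ltr_pdivrMr // truncnS_gt.
pose pt (g : grid m N) : 'rV[R]_m.+1 := \row_i ((grid_coord g i)%:R / N%:R).
have ptS g : stdsimplex (pt g).
  split=> [i|]; first by rewrite mxE divr_ge0.
  under eq_bigr do rewrite mxE.
  by rewrite -mulr_suml -natr_sum sum_grid_coord divff ?gt_eqF.
have labelP g : exists i, pt g 0 i <= G (pt g) 0 i.
  exact: stdsimplex_coord_le (ptS g) (GS _ (ptS g)).
have [a [g ga] aP] := sperner_grid (fun g => xchoose (labelP g)).
exists (pt g) => // i; have [ai|[h ha hi]] := aP i.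
  left; apply: le_lt_trans mN; rewrite mxE ler_pM2r ?invr_gt0 // ler_nat.
  by have /andP[_] := ga i; rewrite ai.
right; exists (pt h) => //; split; last by rewrite -hi; apply: (xchooseP (labelP h)).
split=> // j k; rewrite !mxE /ball /= -mulrBl normrM normfV (ger0_norm (ler0n _ N)).
apply: le_lt_trans mN; rewrite ler_pM2r ?invr_gt0 //.
have /andP[gl gu] := ga k; have /andP[hl hu] := ha k.
rewrite ler_distl lerBlDr -!natrD !ler_nat.
by rewrite (leq_trans hu) ?(leq_trans gu) // leq_add2r.
Qed.

Lemma near_not_almost_fixed G c i : G @ within stdsimplex (nbhs c) --> G c ->
  0 <= G c 0 i < c 0 i -> \forall x \near c & e \near 0^'+, ~ almost_fixed G e x.
Proof.
move=> Gcont /andP[Gc0 Gci].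
have : \forall y \near within stdsimplex (nbhs c), G y 0 i < y 0 i.
  have : (fun y : 'rV_m.+1 => y 0 i - G y 0 i) @ within stdsimplex (nbhs c) -->
      c 0 i - G c 0 i.
    apply: cvgB; first by apply: cvg_within_filter; apply: coord_continuous.
    by apply: (@cvg_comp _ _ _ G (fun y => y 0 i) _ _ _ Gcont); apply: coord_continuous.
  move=> /cvgr_gt/(_ 0); rewrite subr_gt0 => /(_ Gci); apply: filterS => y.
  by rewrite subr_gt0.
move=> /nbhs_ballP[r /= r0 rG]; pose d := Num.min r (c 0 i) / 2.
have d0 : 0 < d by rewrite divr_gt0 // lt_min r0 (le_lt_trans Gc0).
exists (ball c d, [set e | e < d]).
  by split; [exact: nbhsx_ballx | exact: nbhs_right_lt].
move=> [x e] /= [cx ed] xe; have dd : d + d = Num.min r (c 0 i) by rewrite -splitr.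
case: (xe i) => [xi|[y yS [xy]]].
  have [_ /(_ 0 i)] := cx; rewrite /ball /= => /ltr_normlP[_]; rewrite ltrBlDr => cxd.
  have : d + d <= c 0 i by rewrite dd ge_min lexx orbT.
  by move: cxd xi ed; clear; lra.
rewrite leNgt => /negP; apply; apply: rG yS.
apply: (@le_ball _ _ _ (d + e)); last exact: ball_triangle cx xy.
by apply: le_trans (_ : d + d <= _); [rewrite lerD2l ltW | rewrite dd ge_min lexx].
Qed.

Theorem brouwer_stdsimplex G : {within stdsimplex, continuous G} ->
  (forall x, stdsimplex x -> stdsimplex (G x)) -> exists2 x, stdsimplex x & G x = x.
Proof.
move=> /subspace_continuousP Gcont GS; apply: contrapT => nofix.
have /near_covering_withinP covers := (compact_near_coveringP _).1 compact_stdsimplex.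
have : \forall e \near 0^'+, stdsimplex `<=` [set x | ~ almost_fixed G e x].
  apply: (covers _ _ (fun e x => ~ almost_fixed G e x)) => c cS.
  have [|i Gci] := stdsimplex_coord_lt (GS c cS) cS.
    by apply/eqP => Gc; apply: nofix; exists c.
  have [Gc0 _] := GS c cS; have := @near_not_almost_fixed G c i (Gcont c cS).
  rewrite Gc0 Gci => /(_ isT); apply: filterS => -[x e] /= h _; exact: h.
move=> /(filterI (nbhs_right_gt (0 : R)))/filter_ex[e [/= e0 none]].
by have [x xS /none] := almost_fixed_ex GS e0; apply.
Qed.

End StandardSimplex.

Section BoundedMaps.
Local Open Scope ring_scope.
Local Open Scope classical_set_scope.
Variable R : realType.

Lemma row_continuous (T : topologicalType) n (f : T -> 'rV[R]_n) :
  (forall j, continuous (fun x => f x 0 j)) -> continuous f.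
Proof.
move=> fj x; apply/cvg_ballP => e e0; near=> y; split=> // i j; rewrite (ord1 i).
move: j; near: y; apply: filter_forall => j.
by have /cvg_ballP/(_ e e0) := fj j x.
Unshelve. all: end_near.
Qed.

Section CubeToSimplex.
Variables (m : nat) (M L : R).
Hypothesis L0 : 0 < L.

(* For [2 M m <= L], the corner simplex of size [L] translated by [-M] contains the cube of
   the points with coordinates in [-M, M]. *)
Definition simplex_of_cube (x : 'rV[R]_m) : 'rV[R]_m.+1 :=
  \row_i if unlift ord0 i is Some j then (x 0 j + M) / L else 1 - \sum_j (x 0 j + M) / L.

Definition cube_of_simplex (y : 'rV[R]_m.+1) : 'rV[R]_m :=
  \row_j (L * y 0 (lift ord0 j) - M).

Lemma simplex_of_cubeK : cancel simplex_of_cube cube_of_simplex.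
Proof.
by move=> x; apply/rowP => j; rewrite !mxE liftK; field; rewrite gt_eqF.
Qed.

Lemma simplex_of_cube_stdsimplex (x : 'rV[R]_m) : (forall j, `|x 0 j| <= M) -> 2 * M * m%:R <= L ->
  stdsimplex (simplex_of_cube x).
Proof.
move=> xM ML; have xM0 j : 0 <= x 0 j + M.
  by have := xM j; rewrite ler_norml => /andP[+ _]; rewrite -subr_ge0 opprK.
split=> [i|]; last first.
  rewrite big_ord_recl mxE unlift_none.
  by rewrite [X in _ + X](eq_bigr (fun j => (x 0 j + M) / L)) ?subrK // => j _; rewrite mxE liftK.
rewrite mxE; case: unliftP => [j _|_]; first by rewrite divr_ge0 // ltW.
rewrite subr_ge0 -mulr_suml ler_pdivrMr // mul1r (le_trans _ ML) //.
rewrite mulr_natr -[m in _ *+ m]card_ord -sumr_const; apply: ler_sum => j _.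
by have := xM j; rewrite ler_norml => /andP[_ xjM]; lra.
Qed.

Lemma cube_of_simplex_continuous : continuous cube_of_simplex.
Proof.
apply: row_continuous => j; rewrite (_ : (fun y => _) =
    fun y : 'rV[R]_m.+1 => L * y 0 (lift ord0 j) - M).
  move=> y; apply: (@cvgB _ _ _ (nbhs y)); last exact: cvg_cst.
  by apply: (@cvgMl_tmp _ _ (nbhs y)); apply: coord_continuous.
by apply/funext => y; rewrite mxE.
Qed.

Lemma simplex_of_cube_continuous : continuous simplex_of_cube.
Proof.
have coordM j : continuous (fun x : 'rV[R]_m => (x 0 j + M) / L).
  move=> x; apply: (@cvgMr_tmp _ _ (nbhs x)); apply: (@cvgD _ _ _ (nbhs x)); last exact: cvg_cst.
  exact: coord_continuous.
apply: row_continuous => i; rewrite (_ : (fun x => _) = fun x : 'rV[R]_m =>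
    if unlift ord0 i is Some j then (x 0 j + M) / L else 1 - \sum_j (x 0 j + M) / L).
  case: (unlift _ _) => [j|] x; first exact: coordM.
  apply: (@cvgB _ _ _ (nbhs x)); first exact: cvg_cst.
  apply: (@cvg_big _ _ _ _ _ _ _ (nbhs x)) => [|j _]; first exact: add_continuous.
  exact: coordM.
by apply/funext => x; rewrite mxE.
Qed.

End CubeToSimplex.

Theorem brouwer_bounded m (G : 'rV[R]_m -> 'rV[R]_m) (M : R) : continuous G ->
  (forall x j, `|G x 0 j| <= M) -> exists x, G x = x.
Proof.
move=> Gcont GM; pose L := 2 * `|M| * m%:R + 1.
have L0 : 0 < L by rewrite ltr_wpDl // !mulr_ge0.
have ML : 2 * M * m%:R <= L.
  by rewrite ler_wpDr // ler_wpM2r // ler_pM2l // ler_norm.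
pose H := simplex_of_cube M L \o G \o cube_of_simplex M L.
have [||y _ yE] := @brouwer_stdsimplex _ _ H.
- apply: continuous_subspaceT => y; rewrite /H.
  apply: (@continuous_comp _ _ _ (cube_of_simplex M L) (simplex_of_cube M L \o G)).
    exact: cube_of_simplex_continuous.
  by apply: continuous_comp; [apply: Gcont | apply: simplex_of_cube_continuous].
- by move=> y _; apply: simplex_of_cube_stdsimplex ML.
exists (cube_of_simplex M L y).
by rewrite -[in RHS]yE /H /= (simplex_of_cubeK _ L0).
Qed.

End BoundedMaps.

(** * Hermitian matrices and the Frobenius norm *)

Local Open Scope ring_scope.
Local Open Scope complex_scope.
Local Open Scope sesquilinear_scope.

Section ConjugateTranspose.
Variable C : numClosedFieldType.

Lemma trmxCM m n p (A : 'M[C]_(m, n)) (B : 'M_(n, p)) : (A *m B)^t* = B^t* *m A^t*.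
Proof. by rewrite trmx_mul map_mxM. Qed.

Lemma trmxCD m n (A B : 'M[C]_(m, n)) : (A + B)^t* = A^t* + B^t*.
Proof. by rewrite linearD map_mxD. Qed.

Lemma trmxCB m n (A B : 'M[C]_(m, n)) : (A - B)^t* = A^t* - B^t*.
Proof. by rewrite linearB map_mxB. Qed.

Lemma trmxC1 n : (1%:M : 'M[C]_n)^t* = 1%:M.
Proof. by rewrite trmx1 map_mx1. Qed.

Lemma hermsymmxP n (X : 'M[C]_n) : reflect (X^t* = X) (X \is hermsymmx).
Proof. by apply: (iffP (is_hermitianmxP _ _ _)); rewrite expr0 scale1r. Qed.

Lemma hermsymmxB n (X Y : 'M[C]_n) :
  X \is hermsymmx -> Y \is hermsymmx -> X - Y \is hermsymmx.
Proof. by move=> /hermsymmxP hX /hermsymmxP hY; apply/hermsymmxP; rewrite trmxCB hX hY. Qed.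

Lemma hermsymmx_sum n (J : finType) (X : J -> 'M[C]_n) :
  (forall j, X j \is hermsymmx) -> \sum_j X j \is hermsymmx.
Proof.
move=> hX; apply/hermsymmxP; elim/big_ind: _ => [|Y Z hY hZ|j _]; last exact/hermsymmxP.
  by rewrite trmx0 map_mx0.
by rewrite trmxCD hY hZ.
Qed.

Lemma hermsymmx_conj m n (A : 'M[C]_(m, n)) X :
  X \is hermsymmx -> A^t* *m X *m A \is hermsymmx.
Proof. by move=> /hermsymmxP hX; apply/hermsymmxP; rewrite !trmxCM trmxCK hX mulmxA. Qed.

Lemma unitarymxC n (P : 'M[C]_n) : P \is unitarymx -> P^t* *m P = 1%:M.
Proof. by rewrite -trmxC_unitary => /unitarymxP; rewrite trmxCK. Qed.

Lemma unitarymx_conjB n (P U D E : 'M[C]_n) : P \is unitarymx -> U \is unitarymx ->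
  P *m (P^t* *m D *m P - U^t* *m E *m U) *m U^t* = D *m (P *m U^t* ) - P *m U^t* *m E.
Proof.
move=> PP UU; rewrite mulmxBr mulmxBl !mulmxA (unitarymxP PP) mul1mx.
by rewrite (mulmxtVK _ UU).
Qed.

End ConjugateTranspose.

Lemma hermsymmxZ (R : rcfType) n (a : R) (X : 'M[R[i]]_n) :
  X \is hermsymmx -> a%:C *: X \is hermsymmx.
Proof.
move=> /hermsymmxP hX; apply/hermsymmxP; rewrite linearZ map_mxZ hX; congr (_ *: _).
exact: conjc_real.
Qed.

(* Inner product, norm and functional calculus are locked, lest unification unfold them. *)
HB.lock
Definition frodot (R : rcfType) m n (A B : 'M[R[i]]_(m, n)) : R :=
  complex.Re (\tr (A^t* *m B)).

HB.lock
Definition fronorm (R : rcfType) m n (A : 'M[R[i]]_(m, n)) : R := Num.sqrt (frodot A A).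

Section Frobenius.
Variable R : rcfType.

Lemma ler_of_sqr (x y : R) : 0 <= y -> x ^+ 2 <= y ^+ 2 -> x <= y.
Proof.
move=> y0; apply: contraTT; rewrite -!ltNge => yx.
by rewrite ltr_sqr ?nnegrE // (le_trans y0) ?ltW.
Qed.

Section Normc.
Implicit Types (a : R) (z w : R[i]).

Lemma normc_ge0 z : 0 <= normc z.
Proof. by case: z => x y; apply: sqrtr_ge0. Qed.

Lemma normc_sqr z : normc z ^+ 2 = complex.Re z ^+ 2 + complex.Im z ^+ 2.
Proof. by case: z => x y; rewrite sqr_sqrtr // addr_ge0 ?sqr_ge0. Qed.

Lemma normc_real a : normc a%:C = `|a|.
Proof. by rewrite /= expr0n addr0 sqrtr_sqr. Qed.

Lemma mul_conjc z : Num.conj z * z = (normc z ^+ 2)%:C.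
Proof.
by rewrite normc_sqr; case: z => x y; apply/eqP; rewrite eq_complex /=;
  apply/andP; split; apply/eqP; ring.
Qed.

Lemma Re_mul_real a z : complex.Re (a%:C * z) = a * complex.Re z.
Proof. by case: z => x y; rewrite /= mul0r subr0. Qed.

Lemma Re_conjcM z w : complex.Re (Num.conj z * w) = complex.Re (Num.conj w * z).
Proof. by case: z w => x y [u v] /=; ring. Qed.

Lemma normc_conj z : normc (Num.conj z) = normc z.
Proof. by case: z => x y /=; rewrite sqrrN. Qed.

End Normc.

Section InnerProduct.
Variables m n : nat.
Implicit Types (A B D : 'M[R[i]]_(m, n)) (a : R).

Lemma frodotE A B : frodot A B = \sum_i \sum_j complex.Re (Num.conj (A i j) * B i j).
Proof.
rewrite frodot.unlock /mxtrace exchange_big raddf_sum; apply: eq_bigr => j _.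
by rewrite !mxE raddf_sum; apply: eq_bigr => i _; rewrite !mxE.
Qed.

Lemma frodotC A B : frodot A B = frodot B A.
Proof. by rewrite !frodotE; do 2![apply: eq_bigr => ? _]; apply: Re_conjcM. Qed.

Lemma frodotDr A B D : frodot A (B + D) = frodot A B + frodot A D.
Proof. by rewrite frodot.unlock mulmxDr raddfD /= raddfD. Qed.

Lemma frodotNr A B : frodot A (- B) = - frodot A B.
Proof. by rewrite frodot.unlock mulmxN raddfN /= raddfN. Qed.

Lemma frodotZr a A B : frodot A (a%:C *: B) = a * frodot A B.
Proof. by rewrite frodot.unlock -scalemxAr mxtraceZ Re_mul_real. Qed.

Lemma frodotDl A B D : frodot (A + B) D = frodot A D + frodot B D.
Proof. by rewrite frodotC frodotDr !(frodotC D). Qed.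

Lemma frodotZl a A B : frodot (a%:C *: A) B = a * frodot A B.
Proof. by rewrite frodotC frodotZr frodotC. Qed.

Lemma frodot_normc A : frodot A A = \sum_i \sum_j normc (A i j) ^+ 2.
Proof. by rewrite frodotE; do 2![apply: eq_bigr => ? _]; rewrite mul_conjc. Qed.

Lemma frodot_ge0 A : 0 <= frodot A A.
Proof. by rewrite frodot_normc; do 2![apply: sumr_ge0 => ? _]; apply: sqr_ge0. Qed.

Lemma fronorm_ge0 A : 0 <= fronorm A.
Proof. by rewrite fronorm.unlock sqrtr_ge0. Qed.

Lemma sqr_fronorm A : fronorm A ^+ 2 = frodot A A.
Proof. by rewrite fronorm.unlock sqr_sqrtr ?frodot_ge0. Qed.

Lemma normc_le_fronorm A i j : normc (A i j) <= fronorm A.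
Proof.
apply: ler_of_sqr (fronorm_ge0 A) _; rewrite sqr_fronorm frodot_normc.
rewrite (bigD1 i) //= (bigD1 j) //= -addrA lerDl addr_ge0 ?sumr_ge0 // => *.
  exact: sqr_ge0.
by rewrite sumr_ge0 // => *; apply: sqr_ge0.
Qed.

Lemma fronorm0 : fronorm (0 : 'M[R[i]]_(m, n)) = 0.
Proof. by rewrite fronorm.unlock frodot.unlock mulmx0 mxtrace0 sqrtr0. Qed.

Lemma fronorm_eq0 A : (fronorm A == 0) = (A == 0).
Proof.
apply/eqP/eqP => [A0|->]; last exact: fronorm0.
apply/matrixP => i j; rewrite mxE; apply: eq0_normc; apply/eqP.
by rewrite eq_le normc_ge0 -A0 normc_le_fronorm.
Qed.

Lemma fronorm_gt0 A : (0 < fronorm A) = (A != 0).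
Proof. by rewrite lt_def fronorm_ge0 andbT fronorm_eq0. Qed.

Lemma fronormZ a A : fronorm (a%:C *: A) = `|a| * fronorm A.
Proof. by rewrite fronorm.unlock frodotZl frodotZr mulrA -expr2 sqrtrM ?sqr_ge0 // sqrtr_sqr. Qed.

Lemma fronormN A : fronorm (- A) = fronorm A.
Proof. by rewrite fronorm.unlock frodotNr frodotC frodotNr opprK. Qed.

(* Cauchy-Schwarz: expand the square of the norm of [|B| A - |A| B]. *)
Lemma frodot_le A B : frodot A B <= fronorm A * fronorm B.
Proof.
have frodot0 X : frodot X 0 = 0 by rewrite frodot.unlock mulmx0 mxtrace0.
have [->|A0] := eqVneq A 0; first by rewrite frodotC frodot0 mulr_ge0 ?fronorm_ge0.
have [->|B0] := eqVneq B 0; first by rewrite frodot0 mulr_ge0 ?fronorm_ge0.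
have := frodot_ge0 ((fronorm B)%:C *: A + (- fronorm A)%:C *: B).
rewrite !(frodotDl, frodotDr, frodotZl, frodotZr) (frodotC B A) -!sqr_fronorm.
have : 0 < fronorm A * fronorm B by rewrite mulr_gt0 ?fronorm_gt0.
set x := fronorm A; set y := fronorm B; move=> xy0 sq0.
rewrite -(ler_pM2l xy0); move: sq0; lra.
Qed.

Lemma fronormD A B : fronorm (A + B) <= fronorm A + fronorm B.
Proof.
apply: ler_of_sqr; first by rewrite addr_ge0 ?fronorm_ge0.
rewrite sqr_fronorm.
rewrite frodotDl !frodotDr (frodotC B A) -!sqr_fronorm sqrrD.
by have := frodot_le A B; lra.
Qed.

Lemma fronorm_sum (J : finType) (F : J -> 'M[R[i]]_(m, n)) :
  fronorm (\sum_j F j) <= \sum_j fronorm (F j).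
Proof.
elim/big_rec2: _ => [|j x X _ Xx]; first by rewrite fronorm0.
by apply: le_trans (fronormD _ _) _; rewrite lerD2l.
Qed.

End InnerProduct.

Lemma frodot_mull m n p (A : 'M[R[i]]_(m, n)) (B : 'M_(n, p)) D :
  frodot (A *m B) D = frodot B (A^t* *m D).
Proof. by rewrite frodot.unlock trmxCM mulmxA. Qed.

Lemma frodot_mulr m n p (A : 'M[R[i]]_(m, n)) (B : 'M_(n, p)) D :
  frodot D (A *m B) = frodot (A^t* *m D) B.
Proof. by rewrite frodot_mull trmxCK. Qed.

Lemma fronorm_trmxC m n (A : 'M[R[i]]_(m, n)) : fronorm (A^t* ) = fronorm A.
Proof.
rewrite fronorm.unlock !frodot_normc exchange_big; congr Num.sqrt; do 2![apply: eq_bigr => ? _].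
by rewrite !mxE normc_conj.
Qed.

Lemma fronorm_outer m n (u : 'cV[R[i]]_m) (v : 'cV_n) :
  fronorm (u *m v^t* ) = fronorm u * fronorm v.
Proof.
rewrite fronorm.unlock -sqrtrM ?frodot_ge0 // !frodot_normc mulr_suml; congr Num.sqrt.
apply: eq_bigr => i _; rewrite big_ord1 mulr_sumr; apply: eq_bigr => j _.
by rewrite big_ord1 !mxE big_ord1 !mxE normcM normc_conj exprMn.
Qed.

Lemma fronorm_unitary m n (P : 'M[R[i]]_m) (A : 'M_(m, n)) :
  P \is unitarymx -> fronorm (P *m A) = fronorm A.
Proof. by move=> /unitarymxC PP; rewrite fronorm.unlock frodot_mull mulmxA PP mul1mx. Qed.

Lemma fronorm_unitaryr m n (P : 'M[R[i]]_n) (A : 'M_(m, n)) :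
  P \is unitarymx -> fronorm (A *m P) = fronorm A.
Proof.
move=> PP; rewrite -fronorm_trmxC trmxCM (fronorm_unitary (A^t* )) ?trmxC_unitary //.
exact: fronorm_trmxC.
Qed.

Lemma sqr_fronorm_col m n (A : 'M[R[i]]_(m, n)) :
  fronorm A ^+ 2 = \sum_j fronorm (col j A) ^+ 2.
Proof.
rewrite sqr_fronorm frodot_normc exchange_big; apply: eq_bigr => j _.
by rewrite sqr_fronorm frodot_normc; apply: eq_bigr => i _; rewrite big_ord1 mxE.
Qed.

End Frobenius.

Section OperatorNorm.
Variable R : rcfType.

Definition opnorm_le m n (A : 'M[R[i]]_(m, n)) (a : R) :=
  forall v : 'cV_n, fronorm (A *m v) <= a * fronorm v.

Lemma opnorm_le_fronorm m n (A : 'M[R[i]]_(m, n)) : opnorm_le A (fronorm A).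
Proof.
move=> v; have [->|Av0] := eqVneq (A *m v) 0; first by rewrite fronorm0 mulr_ge0 ?fronorm_ge0.
rewrite -fronorm_gt0 in Av0; rewrite -(ler_pM2r Av0) -expr2 sqr_fronorm.
have <- : frodot A (A *m v *m v^t* ) = frodot (A *m v) (A *m v).
  by rewrite frodot_mull frodot.unlock [in RHS]mxtrace_mulC !mulmxA.
by apply: le_trans (frodot_le _ _) _; rewrite fronorm_outer mulrAC mulrA.
Qed.

Lemma opnorm_leM m n p (A : 'M[R[i]]_(m, n)) (B : 'M_(n, p)) a b : 0 <= a ->
  opnorm_le A a -> opnorm_le B b -> opnorm_le (A *m B) (a * b).
Proof.
by move=> a0 hA hB v; rewrite -mulmxA (le_trans (hA _)) // -mulrA ler_wpM2l.
Qed.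

Lemma opnorm_le_trmxC m n (A : 'M[R[i]]_(m, n)) a : 0 <= a ->
  opnorm_le A a -> opnorm_le (A^t* ) a.
Proof.
move=> a0 hA v; set w := A^t* *m v.
have [->|w0] := eqVneq w 0; first by rewrite fronorm0 mulr_ge0 ?fronorm_ge0.
rewrite -fronorm_gt0 in w0; rewrite -(ler_pM2r w0) -expr2 sqr_fronorm {1}/w -frodot_mulr.
apply: le_trans (frodot_le _ _) _.
by rewrite [a * _]mulrC -mulrA ler_wpM2l ?fronorm_ge0.
Qed.

Lemma fronorm_mull_le m n p (A : 'M[R[i]]_(m, n)) (D : 'M_(n, p)) a : 0 <= a ->
  opnorm_le A a -> fronorm (A *m D) <= a * fronorm D.
Proof.
move=> a0 hA; apply: ler_of_sqr; first by rewrite mulr_ge0 ?fronorm_ge0.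
rewrite exprMn !sqr_fronorm_col mulr_sumr; apply: ler_sum => j _.
rewrite -exprMn ler_sqr ?nnegrE ?mulr_ge0 ?fronorm_ge0 // colE -mulmxA -colE.
exact: hA.
Qed.

Lemma fronorm_conj_le m n (A : 'M[R[i]]_(m, n)) (D : 'M_m) a : 0 <= a ->
  opnorm_le A a -> fronorm (A^t* *m D *m A) <= a ^+ 2 * fronorm D.
Proof.
move=> a0 hA; have hA' := opnorm_le_trmxC a0 hA.
rewrite -mulmxA (le_trans (fronorm_mull_le _ a0 hA')) // expr2 -mulrA ler_wpM2l //.
rewrite -fronorm_trmxC trmxCM (le_trans (fronorm_mull_le _ a0 hA')) //.
by rewrite fronorm_trmxC.
Qed.

End OperatorNorm.

(** * Loewner order *)

Section LoewnerOrder.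
Variables (R : rcfType) (n : nat).
Implicit Types (X Y Z : 'M[R[i]]_n) (v w : 'cV[R[i]]_n) (a : R).

Definition qform X v : R := frodot v (X *m v).

Definition loewner_le X Y := forall v, qform X v <= qform Y v.

Lemma qformD X Y v : qform (X + Y) v = qform X v + qform Y v.
Proof. by rewrite /qform mulmxDl frodotDr. Qed.

Lemma qformB X Y v : qform (X - Y) v = qform X v - qform Y v.
Proof. by rewrite /qform mulmxBl frodotDr frodotNr. Qed.

Lemma qformZ a X v : qform (a%:C *: X) v = a * qform X v.
Proof. by rewrite /qform -scalemxAl frodotZr. Qed.

Lemma qform_sum (J : finType) (X : J -> 'M[R[i]]_n) v :
  qform (\sum_j X j) v = \sum_j qform (X j) v.
Proof.
elim/big_rec2: _ => [|j x Y _ <-]; last exact: qformD.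
by rewrite /qform mul0mx frodot.unlock mulmx0 mxtrace0.
Qed.

Lemma qform_scalar a v : qform (a%:C%:M) v = a * fronorm v ^+ 2.
Proof. by rewrite -scalemx1 qformZ /qform mul1mx sqr_fronorm. Qed.

Lemma qform1 v : qform 1%:M v = fronorm v ^+ 2.
Proof. by rewrite (qform_scalar 1) mul1r. Qed.

Lemma loewner_le_trans Y X Z : loewner_le X Y -> loewner_le Y Z -> loewner_le X Z.
Proof. by move=> XY YZ v; apply: le_trans (XY v) (YZ v). Qed.

Lemma loewner_leB X Y Z : loewner_le (X + Y) Z -> loewner_le X (Z - Y).
Proof. by move=> XYZ v; have := XYZ v; rewrite qformD qformB lerBrDr. Qed.

Lemma loewner_le_sum (J : finType) (X Y : J -> 'M[R[i]]_n) :
  (forall j, loewner_le (X j) (Y j)) -> loewner_le (\sum_j X j) (\sum_j Y j).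
Proof. by move=> XY v; rewrite !qform_sum; apply: ler_sum => j _; apply: XY. Qed.

Lemma loewner_le_fronorm X : loewner_le X (fronorm X)%:C%:M.
Proof.
move=> v; rewrite qform_scalar; apply: le_trans (frodot_le _ _) _.
rewrite mulrC expr2 mulrA ler_wpM2r ?fronorm_ge0 //; exact: opnorm_le_fronorm.
Qed.

End LoewnerOrder.

Section Congruence.
Variables (R : rcfType) (m n : nat) (A : 'M[R[i]]_(m, n)).
Implicit Types (X Y : 'M[R[i]]_m) (v : 'cV[R[i]]_n).

Lemma qform_conj X v : qform (A^t* *m X *m A) v = qform X (A *m v).
Proof. by rewrite /qform -!mulmxA frodot_mulr trmxCK. Qed.

Lemma qform_gram v : qform (A^t* *m A) v = fronorm (A *m v) ^+ 2.
Proof. by rewrite -qform1 -qform_conj mulmx1. Qed.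

Lemma loewner_le_conj X Y : loewner_le X Y ->
  loewner_le (A^t* *m X *m A) (A^t* *m Y *m A).
Proof. by move=> XY v; rewrite !qform_conj; apply: XY. Qed.

Lemma opnorm_le_of_gram (a : R) : 0 <= a -> loewner_le (A^t* *m A) (a ^+ 2)%:C%:M ->
  opnorm_le A a.
Proof.
move=> a0 hA v; apply: ler_of_sqr; first by rewrite mulr_ge0 ?fronorm_ge0.
by rewrite -qform_gram exprMn -qform_scalar.
Qed.

End Congruence.

(** * Functional calculus *)

Definition real_diag (R : rcfType) n (d : 'I_n -> R) : 'M[R[i]]_n :=
  diag_mx (\row_i (d i)%:C).

Definition unidiag (R : rcfType) n (P : 'M[R[i]]_n) d : 'M[R[i]]_n :=
  P^t* *m real_diag d *m P.

Definition eigval (R : rcfType) n (X : 'M[R[i]]_n) i : R := complex.Re (spectral_diag X 0 i).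

HB.lock
Definition fcalc (R : rcfType) n (f : R -> R) (X : 'M[R[i]]_n) : 'M[R[i]]_n :=
  unidiag (spectralmx X) (f \o eigval X).

Section FunctionalCalculus.
Variables (R : rcfType) (n : nat).
Implicit Types (X Y P U : 'M[R[i]]_n) (v : 'cV[R[i]]_n) (a b d : 'I_n -> R) (f g : R -> R).
Implicit Types (c L : R).

Lemma real_diag_herm d : real_diag d \is hermsymmx.
Proof.
apply/hermsymmxP/matrixP => i j; rewrite !mxE.
have [->|_] := eqVneq i j; last by rewrite !mulr0n rmorph0.
by rewrite !mulr1n; apply: conjc_real.
Qed.

Lemma unidiag_herm P d : unidiag P d \is hermsymmx.
Proof. exact/hermsymmx_conj/real_diag_herm. Qed.

Lemma eq_unidiag P a b : a =1 b -> unidiag P a = unidiag P b.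
Proof.
move=> ab; rewrite /unidiag; suff -> : real_diag a = real_diag b by [].
by congr diag_mx; apply/rowP => i; rewrite !mxE ab.
Qed.

Lemma real_diagM a b : real_diag a *m real_diag b = real_diag (fun i => a i * b i).
Proof.
by rewrite /real_diag mulmx_diag; congr diag_mx; apply/rowP => i; rewrite !mxE rmorphM.
Qed.

Lemma unidiagM P a b : P \is unitarymx ->
  unidiag P a *m unidiag P b = unidiag P (fun i => a i * b i).
Proof.
by move=> PP; rewrite /unidiag -real_diagM !mulmxA mulmxtVK.
Qed.

Lemma unidiag_cst P c : P \is unitarymx -> unidiag P (fun=> c) = c%:C%:M.
Proof.
move=> PP; rewrite /unidiag /real_diag (_ : \row__ _ = const_mx c%:C).
  by rewrite diag_const_mx mul_mx_scalar -scalemxAl unitarymxC // scalemx1.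
by apply/rowP => i; rewrite !mxE.
Qed.

Lemma qform_unidiag P d v : qform (unidiag P d) v = \sum_i d i * normc ((P *m v) i 0) ^+ 2.
Proof.
rewrite qform_conj /qform frodotE; apply: eq_bigr => i _; rewrite big_ord1.
by rewrite mul_diag_mx !mxE mulrCA mul_conjc -rmorphM.
Qed.

Lemma loewner_le_unidiag P a b : (forall i, a i <= b i) ->
  loewner_le (unidiag P a) (unidiag P b).
Proof.
move=> ab v; rewrite !qform_unidiag; apply: ler_sum => i _.
by rewrite ler_wpM2r ?sqr_ge0.
Qed.

Lemma sqr_fronorm_unidiagB P U a b : P \is unitarymx -> U \is unitarymx ->
  fronorm (unidiag P a - unidiag U b) ^+ 2 =
  \sum_i \sum_j (a i - b j) ^+ 2 * normc ((P *m U^t* ) i j) ^+ 2.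
Proof.
move=> PP UU; have UU' : U^t* \is unitarymx by rewrite trmxC_unitary.
rewrite -(fronorm_unitaryr _ UU') -(fronorm_unitary _ PP).
rewrite /unidiag mulmxA (unitarymx_conjB _ _ PP UU) sqr_fronorm frodot_normc.
do 2![apply: eq_bigr => ? _].
rewrite mul_diag_mx mul_mx_diag !mxE mulrC -mulrBr -rmorphB mulrC.
by rewrite normcM normc_real exprMn real_normK ?num_real.
Qed.

Lemma unidiag_fun_eq f P U a b : P \is unitarymx -> U \is unitarymx ->
  unidiag P a = unidiag U b -> unidiag P (f \o a) = unidiag U (f \o b).
Proof.
move=> PP UU E; apply/eqP; rewrite -subr_eq0 -fronorm_eq0 -sqrf_eq0 sqr_fronorm_unidiagB //.
have : fronorm (unidiag P a - unidiag U b) ^+ 2 == 0.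
  by rewrite E subrr fronorm0 expr0n.
rewrite sqr_fronorm_unidiagB // !pair_big /= !psumr_eq0 => [|p _|p _]; last 2 first.
- by rewrite mulr_ge0 ?sqr_ge0.
- by rewrite mulr_ge0 ?sqr_ge0.
move=> /allP zero; apply/allP => p /zero /=.
rewrite !(mulf_eq0 (_ ^+ 2)) !sqrf_eq0 !subr_eq0.
by move=> /orP[/eqP->|->]; rewrite ?eqxx ?orbT.
Qed.

Lemma fcalcE f X : fcalc f X = unidiag (spectralmx X) (f \o eigval X).
Proof. by rewrite fcalc.unlock. Qed.

Lemma fcalc_herm f X : fcalc f X \is hermsymmx.
Proof. by rewrite fcalcE; apply: unidiag_herm. Qed.

Lemma fcalc_id X : X \is hermsymmx -> fcalc id X = X.
Proof.
move=> hX; have diagE : real_diag (id \o eigval X) = diag_mx (spectral_diag X).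
  congr diag_mx; apply/rowP => i; rewrite mxE RRe_real //.
  exact: (mxOverP (hermitian_spectral_diag_real hX)).
rewrite fcalcE /unidiag diagE -(invmx_unitary (spectral_unitarymx X)).
exact/esym/orthomx_spectralP/hermitian_normalmx.
Qed.

Lemma eq_fcalc f g X : (forall i, f (eigval X i) = g (eigval X i)) -> fcalc f X = fcalc g X.
Proof. by rewrite !fcalcE; apply: eq_unidiag. Qed.

Lemma fcalc_unidiag f P d : P \is unitarymx -> fcalc f (unidiag P d) = unidiag P (f \o d).
Proof.
move=> PP; rewrite fcalcE; apply: (unidiag_fun_eq f (spectral_unitarymx _) PP).
by rewrite -(fcalcE id) fcalc_id ?unidiag_herm.
Qed.

Lemma fcalc_comp f g X : fcalc f (fcalc g X) = fcalc (f \o g) X.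
Proof.
by rewrite [fcalc g X]fcalcE fcalc_unidiag ?spectral_unitarymx // fcalcE.
Qed.

Lemma fcalcM f g X : fcalc f X *m fcalc g X = fcalc (fun x => f x * g x) X.
Proof. by rewrite !fcalcE unidiagM ?spectral_unitarymx. Qed.

Lemma fcalc_cst c X : fcalc (fun=> c) X = c%:C%:M.
Proof. by rewrite fcalcE; apply/unidiag_cst/spectral_unitarymx. Qed.

Lemma loewner_le_fcalc f g X : (forall i, f (eigval X i) <= g (eigval X i)) ->
  loewner_le (fcalc f X) (fcalc g X).
Proof. by rewrite !fcalcE; apply: loewner_le_unidiag. Qed.

Lemma sqr_fronorm_fcalcB f X Y :
  fronorm (fcalc f X - fcalc f Y) ^+ 2 =
  \sum_i \sum_j (f (eigval X i) - f (eigval Y j)) ^+ 2 *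
    normc ((spectralmx X *m (spectralmx Y)^t* ) i j) ^+ 2.
Proof. by rewrite !fcalcE sqr_fronorm_unidiagB ?spectral_unitarymx. Qed.

Lemma fcalc_lipschitz f L X Y : X \is hermsymmx -> Y \is hermsymmx -> 0 <= L ->
  (forall i j, `|f (eigval X i) - f (eigval Y j)| <= L * `|eigval X i - eigval Y j|) ->
  fronorm (fcalc f X - fcalc f Y) <= L * fronorm (X - Y).
Proof.
move=> hX hY L0 fL; apply: ler_of_sqr; first by rewrite mulr_ge0 ?fronorm_ge0.
rewrite exprMn.
have := sqr_fronorm_fcalcB id X Y; rewrite (fcalc_id hX) (fcalc_id hY) => ->.
rewrite sqr_fronorm_fcalcB mulr_sumr; apply: ler_sum => i _.
rewrite mulr_sumr; apply: ler_sum => j _.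
rewrite [leRHS]mulrA ler_wpM2r ?sqr_ge0 // -exprMn -real_normK ?num_real //.
rewrite -[leRHS]real_normK ?num_real // ler_sqr ?nnegrE // normrM (ger0_norm L0).
exact: fL.
Qed.

Lemma opnorm_le_fcalc f X c : 0 <= c -> (forall i, `|f (eigval X i)| <= c) ->
  opnorm_le (fcalc f X) c.
Proof.
move=> c0 fc; apply: (opnorm_le_of_gram c0).
rewrite (hermsymmxP _ (fcalc_herm f X)) fcalcM -(fcalc_cst _ X).
apply: loewner_le_fcalc => i; rewrite -expr2 -real_normK ?num_real //.
by rewrite ler_sqr ?nnegrE.
Qed.

Definition eigvec X i : 'cV[R[i]]_n := col i ((spectralmx X)^t* ).

Lemma fronorm_eigvec X i : fronorm (eigvec X i) = 1.
Proof.
apply/eqP; rewrite -(eqrXn2 (n := 2)) ?fronorm_ge0 // expr1n sqr_fronorm frodotE; apply/eqP.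
have /matrixP/(_ i i)/(congr1 (@complex.Re R)) := unitarymxP (spectral_unitarymx X).
rewrite !mxE eqxx raddf_sum => /= <-; apply: eq_bigr => k _.
by rewrite big_ord1 !mxE conjCK.
Qed.

Lemma eigvecP X i : X \is hermsymmx -> X *m eigvec X i = (eigval X i)%:C *: eigvec X i.
Proof.
move=> hX; rewrite -{1}(fcalc_id hX) fcalcE /unidiag /eigvec !colE mulmxA.
rewrite (mulmxtVK _ (spectral_unitarymx X)) -!colE /real_diag mul_mx_diag.
by apply/colP => k; rewrite !mxE mulrC.
Qed.

Lemma qform_eigvec X i : X \is hermsymmx -> qform X (eigvec X i) = eigval X i.
Proof.
by move=> hX; rewrite /qform eigvecP // frodotZr -sqr_fronorm fronorm_eigvec expr1n mulr1.
Qed.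

Lemma eigval_ge c X : X \is hermsymmx -> loewner_le c%:C%:M X -> forall i, c <= eigval X i.
Proof.
move=> hX cX i; have := cX (eigvec X i).
by rewrite qform_scalar fronorm_eigvec expr1n mulr1 qform_eigvec.
Qed.

Lemma eigval_le c X : X \is hermsymmx -> loewner_le X c%:C%:M -> forall i, eigval X i <= c.
Proof.
move=> hX cX i; have := cX (eigvec X i).
by rewrite qform_scalar fronorm_eigvec expr1n mulr1 qform_eigvec.
Qed.

End FunctionalCalculus.

(** * Powers of positive definite matrices *)

Section RealPowers.
Variable R : realType.

Lemma powR_lipschitz (r c x y : R) : r <= 1 -> 0 < c -> c <= x -> c <= y ->
  `|x `^ r - y `^ r| <= `|r| * c `^ (r - 1) * `|x - y|.
Proof.
move=> r1 c0; wlog xy : x y / x <= y => [wlog cx cy|cx cy].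
  by have [xy|/ltW yx] := leP x y; [exact: wlog | rewrite distrC [`|x - y|]distrC wlog].
have pos z : x <= z -> 0 < z by move=> xz; apply: lt_le_trans xz; apply: lt_le_trans cx.
have der z : x <= z -> is_derive z 1 (@powR R ^~ r) (r * z `^ (r - 1)).
  by move=> xz; apply/is_derive1_powR/pos.
have [//|||z] := @MVT_segment R (@powR R ^~ r) (fun z => r * z `^ (r - 1)) x y.
- by move=> z; rewrite in_itv /= => /andP[/ltW xz _]; apply: der.
- apply: derivable_within_continuous => z; rewrite in_itv /= => /andP[xz _].
  by have [] := der z xz.
rewrite in_itv /= => /andP[xz zy] E; rewrite distrC E normrM [`|x - y|]distrC.
rewrite ler_wpM2r // normrM ler_wpM2l // (ger0_norm (powR_ge0 _ _)).
have cz := le_trans cx xz; have z0 := pos z xz.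
rewrite -(opprB 1 r) !powRN lef_pV2 ?posrE ?powR_gt0 //.
by apply: ge0_ler_powR; rewrite ?nnegrE ?subr_ge0 // ltW.
Qed.

Lemma powR_exponent_continuous (a : R) : 0 < a -> continuous (fun r : R => a `^ r).
Proof.
move=> a0 r; rewrite (_ : (fun r => _) = expR \o (fun r : R => r * ln a)).
  apply: continuous_comp; last exact: continuous_expR.
  exact: mulrr_continuous.
by apply/funext => x; rewrite /= /powR gt_eqF.
Qed.

Local Open Scope classical_set_scope.

Lemma closed_midpoint_itv (A : set R) (a b : R) : closed A -> A a -> A b ->
  (forall x y, A x -> A y -> A ((x + y) / 2)) -> `[a, b] `<=` A.
Proof.
move=> Acl Aa Ab Amid r /=; rewrite in_itv /= => /andP[ar rb]; apply: contrapT => Ar.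
have cpt u v : compact (A `&` `[u, v]).
  by rewrite classical_sets.setIC; apply: compact_closedI => //; apply: segment_compact.
have idc (B : set R) : {within B, continuous id} by apply: continuous_subspaceT => x; apply: cvg_id.
have [|x] := compact_EVT_max _ (cpt a r) (idc _).
  by exists a; split=> //=; rewrite in_itv /= lexx.
move=> /set_mem[Ax]; rewrite /= in_itv /= => /andP[ax xr] xmax.
have [|y] := compact_EVT_min _ (cpt r b) (idc _).
  by exists b; split=> //=; rewrite in_itv /= lexx rb.
move=> /set_mem[Ay]; rewrite /= in_itv /= => /andP[ry yb] ymin.
have xr' : x < r by rewrite lt_neqAle xr andbT; apply/eqP => xE; apply: Ar; rewrite -xE.
have ry' : r < y by rewrite lt_neqAle ry andbT; apply/eqP => yE; apply: Ar; rewrite yE.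
have Az := Amid x y Ax Ay; have [zr|rz] := leP ((x + y) / 2) r.
  suff : (x + y) / 2 <= x by lra.
  by apply/xmax/mem_set; rewrite /= in_itv /= zr andbT; split=> //; lra.
suff : y <= (x + y) / 2 by lra.
by apply/ymin/mem_set; rewrite /= in_itv /= (ltW rz); split=> //=; lra.
Qed.

End RealPowers.

HB.lock
Definition powmx (R : realType) n (X : 'M[R[i]]_n) (r : R) : 'M[R[i]]_n :=
  fcalc (fun x : R => x `^ r) X.

Definition posdefmx (R : realType) n (X : 'M[R[i]]_n) :=
  X \is hermsymmx /\ forall i, 0 < eigval X i.

Section PowersOfMatrices.
Variables (R : realType) (n : nat).
Implicit Types (X Y H S T : 'M[R[i]]_n) (v : 'cV[R[i]]_n) (r s c a : R).

Lemma posdefmx_ge c X : X \is hermsymmx -> 0 < c -> loewner_le c%:C%:M X -> posdefmx X.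
Proof. by move=> hX c0 cX; split=> // i; apply: lt_le_trans (eigval_ge hX cX i). Qed.

Lemma powmxE X r : powmx X r = fcalc (fun x => x `^ r) X.
Proof. by rewrite powmx.unlock. Qed.

Lemma powmx_herm X r : powmx X r \is hermsymmx.
Proof. by rewrite powmxE fcalc_herm. Qed.

Lemma powmx_trmxC X r : (powmx X r)^t* = powmx X r.
Proof. exact/hermsymmxP/powmx_herm. Qed.

Lemma powmxM X r s : powmx (powmx X r) s = powmx X (r * s).
Proof. by rewrite !powmxE fcalc_comp; apply: eq_fcalc => i; rewrite /= powRrM. Qed.

Lemma powmx0 X : powmx X 0 = 1%:M.
Proof.
by rewrite powmxE -[1%:M]/(1%:C%:M) -(fcalc_cst 1 X); apply: eq_fcalc => i; rewrite powRr0.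
Qed.

Lemma powmx1 X : posdefmx X -> powmx X 1 = X.
Proof.
by move=> [hX X0]; rewrite powmxE -[RHS]fcalc_id //; apply: eq_fcalc => i; rewrite powRr1 // ltW.
Qed.

Lemma powmxD X r s : posdefmx X -> powmx X r *m powmx X s = powmx X (r + s).
Proof.
move=> [_ X0]; rewrite !powmxE fcalcM; apply: eq_fcalc => i.
by rewrite powRD //; apply/implyP => _; rewrite gt_eqF.
Qed.

Lemma sqr_fronorm_powmx_half X r v : posdefmx X ->
  fronorm (powmx X (r / 2) *m v) ^+ 2 = qform (powmx X r) v.
Proof. by move=> X0; rewrite -qform_gram powmx_trmxC (powmxD _ _ X0) -splitr. Qed.

Lemma powmx_neq0 X r v : posdefmx X -> v != 0 -> powmx X r *m v != 0.
Proof.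
move=> X0; apply: contraNneq => Xv.
by rewrite -[v]mul1mx -(powmx0 X) -(addNr r) -(powmxD _ _ X0) -mulmxA Xv mulmx0.
Qed.

Lemma posdefmxP X : posdefmx X <->
  X \is hermsymmx /\ forall v, v != 0 -> 0 < qform X v.
Proof.
split=> [X0|[hX X0]].
  have [hX _] := X0; split=> // v v0.
  rewrite -(powmx1 X0) -(sqr_fronorm_powmx_half _ _ X0).
  by rewrite exprn_gt0 // fronorm_gt0 powmx_neq0.
split=> // i; rewrite -(qform_eigvec i hX); apply: X0.
by rewrite -fronorm_eq0 fronorm_eigvec oner_eq0.
Qed.

(* [H] and [S H T] have the same eigenvalues. *)
Lemma loewner_le_of_similar H S T a : H \is hermsymmx -> T *m S = 1%:M ->
  opnorm_le (S *m H *m T) a -> loewner_le H a%:C%:M.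
Proof.
move=> hH TS SHT; rewrite -(fcalc_id hH) -(fcalc_cst a H).
apply: loewner_le_fcalc => i; set e := eigvec H i.
have Se0 : S *m e != 0.
  apply/eqP => Se; have := fronorm_eigvec H i; rewrite -/e -[e]mul1mx -TS -mulmxA Se.
  by rewrite mulmx0 fronorm0 => /eqP; rewrite eq_sym oner_eq0.
have := SHT (S *m e); rewrite -!mulmxA (mulmxA T) TS mul1mx eigvecP // -scalemxAr fronormZ.
by rewrite ler_pM2r ?fronorm_gt0 //; apply: le_trans; apply: ler_norm.
Qed.

Section LoewnerHeinz.
Variables X Y : 'M[R[i]]_n.
Hypotheses (X0 : posdefmx X) (Y0 : posdefmx Y).

Let YD r s : powmx Y r *m powmx Y s = powmx Y (r + s). Proof. exact: powmxD. Qed.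

Lemma opnorm_le_powmx_ratio r : loewner_le (powmx X r) (powmx Y r) ->
  opnorm_le (powmx X (r / 2) *m powmx Y (- (r / 2))) 1.
Proof.
move=> XY; apply: opnorm_le_of_gram ler01 _ => v.
rewrite qform_gram -mulmxA (sqr_fronorm_powmx_half _ _ X0); apply: le_trans (XY _) _.
rewrite -(sqr_fronorm_powmx_half _ _ Y0) mulmxA YD subrr powmx0 mul1mx.
by rewrite expr1n qform1.
Qed.

(* Pedersen's argument: with [c = (r + s) / 2], the Hermitian matrix Y^(-c/2) X^c Y^(-c/2) is
   similar to (X^(r/2) Y^(-r/2))^* (X^(s/2) Y^(-s/2)), a product of two contractions. *)
Lemma loewner_le_powmx_midpoint r s :
  loewner_le (powmx X r) (powmx Y r) -> loewner_le (powmx X s) (powmx Y s) ->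
  loewner_le (powmx X ((r + s) / 2)) (powmx Y ((r + s) / 2)).
Proof.
move=> /opnorm_le_powmx_ratio Xr /opnorm_le_powmx_ratio Xs; set c := (r + s) / 2.
pose H := powmx Y (- (c / 2)) *m powmx X c *m powmx Y (- (c / 2)).
have hH : H \is hermsymmx.
  by rewrite /H -{1}(powmx_trmxC Y); apply/hermsymmx_conj/powmx_herm.
have H1 : loewner_le H 1%:C%:M.
  apply: (@loewner_le_of_similar _ (powmx Y ((s - r) / 4)) (powmx Y (- ((s - r) / 4))) _ hH).
    by rewrite YD addNr powmx0.
  have := opnorm_leM ler01 (opnorm_le_trmxC ler01 Xr) Xs; rewrite mulr1 trmxCM !powmx_trmxC.
  rewrite mulmxA -[_ *m powmx X _ *m powmx X _]mulmxA (powmxD _ _ X0) -mulrDl -/c.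
  rewrite /H !mulmxA YD -[_ *m powmx Y _ *m powmx Y _]mulmxA YD.
  have -> : (s - r) / 4 - c / 2 = - (r / 2) by rewrite /c; field.
  by have -> : - (c / 2) - (s - r) / 4 = - (s / 2) by rewrite /c; field.
have := @loewner_le_conj _ _ _ (powmx Y (c / 2)) _ _ H1; rewrite powmx_trmxC mulmx1.
rewrite YD -splitr /H !mulmxA YD subrr powmx0 mul1mx.
by rewrite -mulmxA YD addNr powmx0 mulmx1.
Qed.

Lemma qform_powmx_continuous Z v : posdefmx Z -> continuous (fun r => qform (powmx Z r) v).
Proof.
move=> [_ Z0]; rewrite (_ : (fun r => _) = fun r : R =>
    \sum_i eigval Z i `^ r * normc ((spectralmx Z *m v) i 0) ^+ 2); last first.
  by apply/funext => r; rewrite powmxE fcalcE qform_unidiag.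
move=> r; apply: cvg_big => [|i _]; first exact: add_continuous.
by apply: cvgMr_tmp; apply: powR_exponent_continuous.
Qed.

Lemma closed_loewner_le_powmx : closed [set r | loewner_le (powmx X r) (powmx Y r)]%classic.
Proof.
pose gap v r := qform (powmx Y r) v - qform (powmx X r) v.
rewrite (_ : mkset _ = \bigcap_v (gap v @^-1` [set x | 0 <= x]))%classic.
  apply: closed_bigI => v _; apply: preimage_closed => [r _|]; last exact: closed_ge.
  by apply: (@cvgB _ _ _ (nbhs r)); apply: qform_powmx_continuous.
apply/seteqP; split=> [r XY v _|r XY v]; first by rewrite /= subr_ge0.
by have := XY v I; rewrite /= subr_ge0.
Qed.

Theorem loewner_heinz r : loewner_le X Y -> 0 <= r <= 1 ->
  loewner_le (powmx X r) (powmx Y r).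
Proof.
move=> XY r01; apply: (@closed_midpoint_itv _ _ 0 1 closed_loewner_le_powmx) => /=.
- by rewrite !powmx0.
- by rewrite !powmx1.
- exact: loewner_le_powmx_midpoint.
- by rewrite in_itv.
Qed.

End LoewnerHeinz.
End PowersOfMatrices.

(** * Fixed points in Loewner intervals *)

Section RealCoordinates.
Variables (R : realType) (n : nat).
Implicit Types (Z : 'M[R[i]]_n) (x y : 'rV[R]_(n * n + n * n)).

Definition row_of_mx Z : 'rV[R]_(n * n + n * n) :=
  row_mx (mxvec (map_mx (@complex.Re R) Z)) (mxvec (map_mx (@complex.Im R) Z)).

Definition mx_of_row x : 'M[R[i]]_n :=
  \matrix_(i, j) (lsubmx x 0 (mxvec_index i j) +i* rsubmx x 0 (mxvec_index i j)).

Lemma row_of_mxK : cancel row_of_mx mx_of_row.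
Proof.
move=> Z; apply/matrixP => i j; rewrite mxE row_mxKl row_mxKr !mxvecE !mxE.
by case: (Z i j).
Qed.

Lemma row_of_mxB Z1 Z2 : row_of_mx (Z1 - Z2) = row_of_mx Z1 - row_of_mx Z2.
Proof. by rewrite /row_of_mx !raddfB /= opp_row_mx add_row_mx. Qed.

Lemma mx_of_rowB x y : mx_of_row (x - y) = mx_of_row x - mx_of_row y.
Proof. by apply/matrixP => i j; rewrite !mxE. Qed.

Lemma row_of_mx_le Z k : `|row_of_mx Z 0 k| <= fronorm Z.
Proof.
have Re_le z : `|complex.Re z| <= normc z :> R.
  by apply: ler_of_sqr (normc_ge0 z) _; rewrite normc_sqr real_normK ?num_real // lerDl sqr_ge0.
have Im_le z : `|complex.Im z| <= normc z :> R.
  by apply: ler_of_sqr (normc_ge0 z) _; rewrite normc_sqr real_normK ?num_real // lerDr sqr_ge0.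
rewrite /row_of_mx mxE.
case: (fintype.split k) => l; case/mxvec_indexP: l => i j; rewrite mxvecE mxE.
  exact: le_trans (Re_le _) (normc_le_fronorm Z i j).
exact: le_trans (Im_le _) (normc_le_fronorm Z i j).
Qed.

Lemma fronorm_mx_of_row_le x (e : R) : 0 <= e -> (forall k, `|x 0 k| <= e) ->
  fronorm (mx_of_row x) <= 2 * n%:R * e.
Proof.
move=> e0 xe; apply: ler_of_sqr; first by rewrite !mulr_ge0.
have sq k : x 0 k ^+ 2 <= e ^+ 2.
  by rewrite -real_normK ?num_real // ler_sqr ?nnegrE.
rewrite sqr_fronorm frodot_normc; apply: (@le_trans _ _ (\sum_(i < n) \sum_(j < n) 2 * e ^+ 2)).
  do 2![apply: ler_sum => ? _]; rewrite mxE normc_sqr /= !mxE mulr_natl mulr2n.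
  by apply: lerD; apply: sq.
rewrite !sumr_const !card_ord -mulrnA -[_ *+ (n * n)]mulr_natr natrM.
have : 0 <= (n%:R * e) ^+ 2 by apply: sqr_ge0.
by rewrite !exprMn; lra.
Qed.

Lemma lipschitz_row_continuous (F : 'M[R[i]]_n -> 'M[R[i]]_n) (K : R) : 0 <= K ->
  (forall Z1 Z2, fronorm (F Z1 - F Z2) <= K * fronorm (Z1 - Z2)) ->
  continuous (row_of_mx \o F \o mx_of_row).
Proof.
move=> K0 FK; pose L := K * (2 * n%:R) + 1.
have L0 : 0 < L by rewrite ltr_wpDl // !mulr_ge0.
apply: row_continuous => k x.
apply/(@cvgrPdist_lt _ _ _ (nbhs x) (nbhs_filter x)) => e e0; near=> y.
have xy l : `|(x - y) 0 l| <= e / L.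
  have : ball x (e / L) y by near: y; apply: nbhsx_ballx; rewrite divr_gt0.
  by case=> _ /(_ 0 l); rewrite /ball /= !mxE => /ltW.
have -> : (row_of_mx \o F \o mx_of_row) x 0 k - (row_of_mx \o F \o mx_of_row) y 0 k =
    row_of_mx (F (mx_of_row x) - F (mx_of_row y)) 0 k by rewrite row_of_mxB !mxE.
apply: le_lt_trans (row_of_mx_le _ _) _; apply: le_lt_trans (FK _ _) _.
rewrite -mx_of_rowB; have := fronorm_mx_of_row_le (ltW (divr_gt0 e0 L0)) xy.
move=> /(ler_wpM2l K0)/le_lt_trans; apply.
by rewrite !mulrA ltr_pdivrMr // mulrC ltr_pM2l // -!mulrA ltrDl.
Unshelve. all: end_near.
Qed.

End RealCoordinates.

Section LoewnerInterval.
Variables (R : realType) (n : nat) (a b : R).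
Hypothesis ab : a <= b.
Implicit Types (X Y Z : 'M[R[i]]_n) (x y : R).

Definition loewner_itv : set 'M[R[i]]_n :=
  [set X | [/\ X \is hermsymmx, loewner_le a%:C%:M X & loewner_le X b%:C%:M]]%classic.

Lemma fronorm_loewner_itv_le X : loewner_itv X ->
  fronorm X <= (`|a| + `|b|) * fronorm (1%:M : 'M[R[i]]_n).
Proof.
move=> [hX aX Xb]; rewrite -[X in fronorm X <= _]mulmx1.
apply: fronorm_mull_le; rewrite ?addr_ge0 // -[X](fcalc_id hX).
apply: opnorm_le_fcalc => [|i]; first by rewrite addr_ge0.
have := eigval_ge hX aX i; have := eigval_le hX Xb i; rewrite ler_norml.
have := ler_norm b; have := ler_norm (- a); rewrite normrN.
have := normr_ge0 a; have := normr_ge0 b; lra.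
Qed.

Definition clamp x := Num.max a (Num.min b x).

Lemma clamp_itv x : a <= clamp x <= b.
Proof. by rewrite /clamp le_max lexx ge_max ab ge_min lexx. Qed.

Lemma clamp_id x : a <= x <= b -> clamp x = x.
Proof. by case/andP => ax xb; rewrite /clamp (min_idPr xb) (max_idPr ax). Qed.

Lemma clamp_lipschitz x y : `|clamp x - clamp y| <= `|x - y|.
Proof.
have := ler_norm (x - y); have := ler_norm (y - x); rewrite distrC.
rewrite ler_norml /clamp.
by case: (leP b x) => ?; case: (leP b y) => ?; do ?case: (leP a _) => ?; lra.
Qed.

Definition herm_part Z : 'M[R[i]]_n := (2^-1)%:C *: (Z + Z^t* ).

Lemma herm_part_herm Z : herm_part Z \is hermsymmx.
Proof.
apply/hermsymmxP/matrixP => i j; rewrite !mxE rmorphM rmorphD /= conjCK addrC.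
by congr (_ * _); apply: conjc_real.
Qed.

Lemma herm_part_id X : X \is hermsymmx -> herm_part X = X.
Proof.
move=> /hermsymmxP hX; rewrite /herm_part hX scalerDr -scalerDl -rmorphD.
by rewrite (_ : 2^-1 + 2^-1 = 1 :> R) ?scale1r //; field.
Qed.

Lemma herm_part_lipschitz Z1 Z2 :
  fronorm (herm_part Z1 - herm_part Z2) <= fronorm (Z1 - Z2).
Proof.
rewrite /herm_part -scalerBr opprD addrACA -trmxCB fronormZ ger0_norm ?invr_ge0 //.
rewrite mulrC ler_pdivrMr // mulr_natr mulr2n; apply: le_trans (fronormD _ _) _.
by rewrite fronorm_trmxC.
Qed.

Definition loewner_retract Z := fcalc clamp (herm_part Z).

Lemma loewner_retract_itv Z : loewner_itv (loewner_retract Z).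
Proof.
have clampP i := andP (clamp_itv (eigval (herm_part Z) i)).
split; first exact: fcalc_herm.
  by rewrite -(fcalc_cst a (herm_part Z)); apply: loewner_le_fcalc => i; case: (clampP i).
by rewrite -(fcalc_cst b (herm_part Z)); apply: loewner_le_fcalc => i; case: (clampP i).
Qed.

Lemma loewner_retract_id X : loewner_itv X -> loewner_retract X = X.
Proof.
move=> [hX aX Xb]; rewrite /loewner_retract herm_part_id // -[RHS](fcalc_id hX).
by apply: eq_fcalc => i; rewrite clamp_id // (eigval_ge hX) ?(eigval_le hX).
Qed.

Lemma loewner_retract_lipschitz Z1 Z2 :
  fronorm (loewner_retract Z1 - loewner_retract Z2) <= fronorm (Z1 - Z2).
Proof.
apply: le_trans (herm_part_lipschitz _ _); rewrite -[leRHS]mul1r.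
apply: fcalc_lipschitz; rewrite ?herm_part_herm // => i j.
by rewrite mul1r clamp_lipschitz.
Qed.

Theorem lipschitz_loewner_itv_fixpoint (G : 'M[R[i]]_n -> 'M[R[i]]_n) (K : R) : 0 <= K ->
  (forall X, loewner_itv X -> loewner_itv (G X)) ->
  (forall X Y, loewner_itv X -> loewner_itv Y -> fronorm (G X - G Y) <= K * fronorm (X - Y)) ->
  exists2 X, loewner_itv X & G X = X.
Proof.
move=> K0 Gitv GK; pose F := G \o loewner_retract.
have FK Z1 Z2 : fronorm (F Z1 - F Z2) <= K * fronorm (Z1 - Z2).
  apply: le_trans (GK _ _ (loewner_retract_itv _) (loewner_retract_itv _)) _.
  by rewrite ler_wpM2l // loewner_retract_lipschitz.
have Fitv Z : loewner_itv (F Z) by apply/Gitv/loewner_retract_itv.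
have [x k|x xE] := @brouwer_bounded _ _ _ ((`|a| + `|b|) * fronorm (1%:M : 'M[R[i]]_n))
    (lipschitz_row_continuous K0 FK).
  exact: le_trans (row_of_mx_le _ _) (fronorm_loewner_itv_le (Fitv _)).
have FE : F (mx_of_row x) = mx_of_row x by rewrite -[RHS](congr1 _ xE) /= row_of_mxK.
exists (mx_of_row x); first by rewrite -FE.
by rewrite -[RHS]FE /F /= loewner_retract_id // -FE.
Qed.

End LoewnerInterval.

(** * The matrix equation *)

Section PowerBounds.
Variables (R : realType) (n : nat).
Implicit Types (X Y : 'M[R[i]]_n) (c r : R).

Lemma qform_powmx_ge0 X r v : 0 <= qform (powmx X r) v.
Proof.
have := @loewner_le_fcalc _ _ (fun=> 0) (fun x => x `^ r) X (fun i => powR_ge0 _ _) v.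
by rewrite fcalc_cst qform_scalar mul0r -powmxE.
Qed.

Lemma powmx_scalar_le c r X : X \is hermsymmx -> 0 < c -> 0 <= r ->
  loewner_le c%:C%:M X -> loewner_le (c `^ r)%:C%:M (powmx X r).
Proof.
move=> hX c0 r0 cX; rewrite -(fcalc_cst _ X) powmxE; apply: loewner_le_fcalc => i.
have ci := eigval_ge hX cX i; have i0 := lt_le_trans c0 ci.
by apply: ge0_ler_powR; rewrite ?nnegrE // ltW.
Qed.

Lemma powmxN_le_scalar c r X : X \is hermsymmx -> 0 < c -> 0 <= r ->
  loewner_le c%:C%:M X -> loewner_le (powmx X (- r)) (c `^ (- r))%:C%:M.
Proof.
move=> hX c0 r0 cX; rewrite -(fcalc_cst _ X) powmxE; apply: loewner_le_fcalc => i.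
have ci := eigval_ge hX cX i; have i0 := lt_le_trans c0 ci.
rewrite !powRN lef_pV2 ?posrE ?powR_gt0 //.
by apply: ge0_ler_powR; rewrite ?nnegrE // ltW.
Qed.

Lemma powmx_lipschitz c r X Y : r <= 1 -> 0 < c -> X \is hermsymmx -> Y \is hermsymmx ->
  loewner_le c%:C%:M X -> loewner_le c%:C%:M Y ->
  fronorm (powmx X r - powmx Y r) <= `|r| * c `^ (r - 1) * fronorm (X - Y).
Proof.
move=> r1 c0 hX hY cX cY; rewrite !powmxE; apply: fcalc_lipschitz => // [|i j].
  by rewrite mulr_ge0 ?powR_ge0.
by apply: powR_lipschitz; rewrite ?(eigval_ge hX) ?(eigval_ge hY).
Qed.

End PowerBounds.

Section MatrixEquation.
Variables (R : realType) (n : nat) (J : finType).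
Variables (A : J -> 'M[R[i]]_n) (t : J -> R) (Q : 'M[R[i]]_n) (s : R).
Implicit Types (X Y : 'M[R[i]]_n) (c : R).

Definition negpow_sum X := \sum_j (A j)^t* *m powmx X (- t j) *m A j.

Definition eqn_solution X := powmx X s + negpow_sum X = Q.

Definition residual X := Q - negpow_sum X.

Definition eqn_step X := powmx (residual X) (1 / s).

(* [residual X >= c^s I] holds for every [X >= c I] as soon as it holds for [c I]. *)
Definition eqn_floor c := loewner_le
  ((c `^ s)%:C%:M + \sum_j (c `^ (- t j))%:C *: ((A j)^t* *m A j)) Q.

Lemma negpow_sum_herm X : negpow_sum X \is hermsymmx.
Proof. by apply: hermsymmx_sum => j; apply/hermsymmx_conj/powmx_herm. Qed.

Lemma qform_negpow_sum_ge0 X v : 0 <= qform (negpow_sum X) v.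
Proof. by rewrite qform_sum sumr_ge0 // => j _; rewrite qform_conj qform_powmx_ge0. Qed.

Variable c : R.
Hypotheses (s1 : 1 <= s) (t0 : forall j, 0 <= t j) (c0 : 0 < c) (hQ : Q \is hermsymmx).

Hypothesis floorQ : eqn_floor c.

Let s0 : 0 < s. Proof. exact: lt_le_trans s1. Qed.

Let invs_gt0 : 0 < 1 / s. Proof. by rewrite divr_gt0. Qed.

Let invs_le1 : 1 / s <= 1. Proof. by rewrite ler_pdivrMr // mul1r. Qed.

Let powRsK (x : R) : 0 < x -> (x `^ s) `^ (1 / s) = x.
Proof. by move=> x0; rewrite -powRrM mulrC divfK ?gt_eqF // powRr1 // ltW. Qed.

Let cs0 : 0 < c `^ s. Proof. exact: powR_gt0. Qed.

Lemma negpow_sum_le X : X \is hermsymmx -> loewner_le c%:C%:M X ->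
  loewner_le (negpow_sum X) (\sum_j (c `^ (- t j))%:C *: ((A j)^t* *m A j)).
Proof.
move=> hX cX; apply: loewner_le_sum => j.
have := loewner_le_conj (A j) (powmxN_le_scalar hX c0 (t0 j) cX).
by rewrite mul_mx_scalar -scalemxAl.
Qed.

Lemma residual_herm X : residual X \is hermsymmx.
Proof. exact: hermsymmxB hQ (negpow_sum_herm X). Qed.

Lemma residual_ge X : X \is hermsymmx -> loewner_le c%:C%:M X ->
  loewner_le (c `^ s)%:C%:M (residual X).
Proof.
move=> hX cX; apply: loewner_leB => v; apply: le_trans (floorQ v).
by rewrite !qformD lerD2l negpow_sum_le.
Qed.

Lemma residual_le X : loewner_le (residual X) Q.
Proof. by move=> v; rewrite /residual qformB lerBlDr lerDl qform_negpow_sum_ge0. Qed.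

Lemma eqn_step_ge X : X \is hermsymmx -> loewner_le c%:C%:M X ->
  loewner_le c%:C%:M (eqn_step X).
Proof.
move=> hX cX; rewrite -(powRsK c0).
exact: powmx_scalar_le (residual_herm X) cs0 (ltW invs_gt0) (residual_ge hX cX).
Qed.

Lemma eqn_step_le X : X \is hermsymmx -> loewner_le c%:C%:M X ->
  loewner_le (eqn_step X) (powmx Q (1 / s)).
Proof.
move=> hX cX; have rX := residual_ge hX cX.
apply: loewner_heinz (residual_le X) _; last by rewrite ltW.
  exact: posdefmx_ge (residual_herm X) cs0 rX.
exact: posdefmx_ge hQ cs0 (loewner_le_trans rX (residual_le X)).
Qed.

Lemma eqn_solutionP X : X \is hermsymmx -> loewner_le c%:C%:M X ->
  eqn_solution X <-> eqn_step X = X.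
Proof.
move=> hX cX; rewrite /eqn_step; split=> [solX|stepX].
  rewrite /residual -{1}solX addrK powmxM mulrC divfK ?gt_eqF // powmx1 //.
  exact: posdefmx_ge hX c0 cX.
rewrite /eqn_solution -{1}stepX powmxM divfK ?gt_eqF // powmx1 ?subrK //.
exact: posdefmx_ge (residual_herm X) cs0 (residual_ge hX cX).
Qed.

Section Contraction.
Variable a : J -> R.
Hypotheses (a0 : forall j, 0 <= a j) (opA : forall j, opnorm_le (A j) (a j)).

Definition eqn_rate := 1 / s * c `^ (1 - s) * \sum_j t j * c `^ (- t j - 1) * a j ^+ 2.

Lemma eqn_rate_ge0 : 0 <= eqn_rate.
Proof.
apply: mulr_ge0; first by rewrite mulr_ge0 ?powR_ge0 // ltW.
by apply: sumr_ge0 => j _; rewrite !mulr_ge0 ?powR_ge0 ?sqr_ge0.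
Qed.

Lemma negpow_sum_lipschitz X Y : X \is hermsymmx -> Y \is hermsymmx ->
  loewner_le c%:C%:M X -> loewner_le c%:C%:M Y ->
  fronorm (negpow_sum X - negpow_sum Y) <=
  (\sum_j t j * c `^ (- t j - 1) * a j ^+ 2) * fronorm (X - Y).
Proof.
move=> hX hY cX cY; rewrite /negpow_sum -sumrB mulr_suml.
apply: le_trans (fronorm_sum _) _; apply: ler_sum => j _.
rewrite -mulmxBl -mulmxBr; apply: le_trans (fronorm_conj_le _ (a0 j) (opA j)) _.
rewrite [_ * a j ^+ 2]mulrC -[leRHS]mulrA ler_wpM2l ?sqr_ge0 //.
have tN1 : - t j <= 1 by rewrite (le_trans _ ler01) // oppr_le0.
have := powmx_lipschitz tN1 c0 hX hY cX cY.
by rewrite normrN ger0_norm.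
Qed.

Lemma eqn_step_lipschitz X Y : X \is hermsymmx -> Y \is hermsymmx ->
  loewner_le c%:C%:M X -> loewner_le c%:C%:M Y ->
  fronorm (eqn_step X - eqn_step Y) <= eqn_rate * fronorm (X - Y).
Proof.
move=> hX hY cX cY; have := powmx_lipschitz invs_le1 cs0 (residual_herm X) (residual_herm Y)
  (residual_ge hX cX) (residual_ge hY cY).
rewrite (gtr0_norm invs_gt0) -powRrM mulrBr mulr1 [s * _]mulrC divfK ?gt_eqF //.
move/le_trans; apply; rewrite /eqn_rate -[leRHS]mulrA ler_wpM2l //.
  by rewrite mulr_ge0 ?powR_ge0 // ltW.
rewrite /residual opprD addrACA subrr add0r -opprD fronormN.
exact: negpow_sum_lipschitz.
Qed.

Theorem eqn_solution_uniq X Y : eqn_rate < 1 ->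
  X \is hermsymmx -> Y \is hermsymmx -> loewner_le c%:C%:M X -> loewner_le c%:C%:M Y ->
  eqn_solution X -> eqn_solution Y -> X = Y.
Proof.
move=> rate1 hX hY cX cY /(eqn_solutionP hX cX) XE /(eqn_solutionP hY cY) YE.
apply/eqP; rewrite -subr_eq0 -fronorm_eq0; apply: contraTT rate1 => XY0.
have := eqn_step_lipschitz hX hY cX cY; rewrite XE YE -leNgt -{1}[fronorm _]mul1r.
by rewrite ler_pM2r // lt_def XY0 fronorm_ge0.
Qed.

End Contraction.

Theorem eqn_solution_ex : exists X, [/\ X \is hermsymmx, loewner_le c%:C%:M X,
  loewner_le X (powmx Q (1 / s)) & eqn_solution X].
Proof.
pose b := Num.max c (fronorm (powmx Q (1 / s))).
have cb : c <= b by rewrite le_max lexx.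
have Qb : loewner_le (powmx Q (1 / s)) b%:C%:M.
  apply: loewner_le_trans (loewner_le_fronorm _) _ => v.
  by rewrite !qform_scalar ler_wpM2r ?sqr_ge0 // le_max lexx orbT.
have opA j : opnorm_le (A j) (fronorm (A j)) by apply: opnorm_le_fronorm.
have [X [hX cX _]|X Y [hX cX _] [hY cY _]|X [hX cX _] stepX] :=
    lipschitz_loewner_itv_fixpoint cb (eqn_rate_ge0 (fun j => fronorm_ge0 (A j))) (G := eqn_step).
- split; [exact: powmx_herm | exact: eqn_step_ge |].
  exact: loewner_le_trans (eqn_step_le hX cX) Qb.
- exact: (eqn_step_lipschitz (fun j => fronorm_ge0 (A j)) opA).
exists X; split=> //; first by rewrite -stepX; apply: eqn_step_le.
exact/eqn_solutionP.
Qed.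

End MatrixEquation.

Section GramBounds.
Variables (R : realType) (n : nat).
Implicit Types (A Q : 'M[R[i]]_n) (a : R).

(* With S = Q^(-1/2), both sides say that A S is bounded by the square root of a. *)
Lemma gram_le_of_conj_inv A Q a : posdefmx Q -> 0 <= a ->
  loewner_le (A *m powmx Q (-1) *m A^t* ) a%:C%:M -> loewner_le (A^t* *m A) (a%:C *: Q).
Proof.
move=> Q0 a0 hA; pose S := powmx Q (- 2^-1); have hS : S^t* = S by apply: powmx_trmxC.
have opSA : opnorm_le (S *m A^t* ) (Num.sqrt a).
  apply: opnorm_le_of_gram (sqrtr_ge0 a) _; rewrite trmxCM trmxCK hS (sqr_sqrtr a0).
  rewrite mulmxA -[A *m S *m S]mulmxA (powmxD _ _ Q0).
  have -> : - 2^-1 - 2^-1 = -1 :> R by field.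
  exact: hA.
have := opnorm_le_trmxC (sqrtr_ge0 a) opSA; rewrite trmxCM trmxCK hS => opAS v.
have := opAS (powmx Q (1 / 2) *m v); rewrite -mulmxA (mulmxA S) (powmxD _ _ Q0) div1r addNr.
rewrite powmx0 mul1mx => Av; rewrite qform_gram qformZ.
rewrite -(powmx1 Q0) -(sqr_fronorm_powmx_half _ _ Q0) -[a in leRHS](sqr_sqrtr a0) -exprMn.
by rewrite div1r ler_sqr ?nnegrE ?mulr_ge0 ?sqrtr_ge0 ?fronorm_ge0.
Qed.

Section ScaledFloor.
Variables (J : finType) (A : J -> 'M[R[i]]_n) (t : J -> R) (Q : 'M[R[i]]_n) (s k c : R).
Hypotheses (Q0 : posdefmx Q) (k0 : 0 < k) (c0 : 0 < c).
Hypothesis sumk : \sum_j k `^ (- t j) < 1.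
Hypothesis conjA : forall j, loewner_le (A j *m powmx Q (-1) *m (A j)^t* ) (c `^ t j)%:C%:M.
Hypothesis invQ : loewner_le ((c `^ s)%:C *: powmx Q (-1))
  ((1 - \sum_j k `^ (- t j)) * k `^ (- s))%:C%:M.

Lemma eqn_floor_scaled : eqn_floor A t Q s (k * c).
Proof.
pose kappa := \sum_j k `^ (- t j); move=> v; rewrite qformD qform_scalar qform_sum.
have gap0 : 0 < 1 - kappa by rewrite subr_gt0.
have scaleN r : (k * c) `^ (- r) * c `^ r = k `^ (- r).
  by rewrite powRM ?ltW // !powRN -mulrA mulVf ?mulr1 // gt_eqF // powR_gt0.
have gramA : \sum_j qform (((k * c) `^ (- t j))%:C *: ((A j)^t* *m A j)) v <=
    kappa * qform Q v.
  rewrite mulr_suml; apply: ler_sum => j _; rewrite qformZ -scaleN -mulrA.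
  rewrite ler_wpM2l ?powR_ge0 //.
  by have := gram_le_of_conj_inv Q0 (powR_ge0 _ _) (conjA j) v; rewrite qformZ.
have floor : (k * c) `^ s * fronorm v ^+ 2 <= (1 - kappa) * qform Q v.
  have inv1 : loewner_le (1%:M *m powmx Q (-1) *m 1%:M^t* ) ((1 - kappa) * (k * c) `^ (- s))%:C%:M.
    rewrite trmxC1 mul1mx mulmx1 => w; rewrite -(ler_pM2l (powR_gt0 s c0)).
    have := invQ w; rewrite qformZ !qform_scalar -/kappa -(scaleN s) => /le_trans; apply.
    by lra.
  have := gram_le_of_conj_inv Q0 (mulr_ge0 (ltW gap0) (powR_ge0 _ _)) inv1 v.
  rewrite trmxC1 mul1mx qform1 qformZ powRN mulrAC ler_pdivlMr 1?mulrC // powR_gt0 //.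
  exact: mulr_gt0.
by rewrite -[qform Q v]mul1r -[1](subrK kappa) mulrDl lerD.
Qed.

End ScaledFloor.
End GramBounds.

(** * Functions on indices as complex matrices *)

Definition complex_of (z : Defs.C) : R[i] := Complex (Defs.Re z) (Defs.Im z).
Definition of_complex (z : R[i]) : Defs.C := mkC (complex.Re z) (complex.Im z).

Lemma of_complexK : cancel of_complex complex_of.
Proof. by case. Qed.

Lemma complex_of_inj : injective complex_of.
Proof. by move=> [a b] [c d] [-> ->]. Qed.

Lemma complex_of_Cadd x y : complex_of (Cadd x y) = complex_of x + complex_of y.
Proof. by []. Qed.

Lemma complex_of_Csum n f : complex_of (Csum n f) = \sum_(i < n) complex_of (f i).
Proof.
suff sumE k : complex_of (List.fold_right Cadd C0 (List.map f (List.seq k n))) =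
    \sum_(i < n) complex_of (f (k + i)%N).
  by rewrite /Csum sumE; apply: eq_bigr => i _; rewrite add0n.
elim: n k => [|n IH] k; first by rewrite big_ord0.
rewrite big_ord_recl /= complex_of_Cadd IH addn0; congr (_ + _).
by apply: eq_bigr => i _; rewrite /bump /= addnCA addnA.
Qed.

Lemma RpowerE (x y : R) : 0 < x -> Rpower x y = x `^ y.
Proof. by move=> x0; rewrite /Rpower /powR gt_eqF // RexpE RlnE. Qed.

Lemma Rpower_gt0 (x y : R) : 0 < Rpower x y.
Proof. exact/RltP/exp_pos. Qed.

(* [Rpower] is positive even at a nonpositive base. *)
Lemma le_powR_of_Rpower (l x r : R) : 0 < r -> Rpower l (1 / r) <= x -> l <= x `^ r.
Proof.
move=> r0 lx; have [l0|l0] := leP l 0; first by rewrite (le_trans l0) ?powR_ge0.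
rewrite RpowerE // in lx; have -> : l = (l `^ (1 / r)) `^ r.
  by rewrite -powRrM divfK ?gt_eqF // powRr1 // ltW.
by apply: (ge0_ler_powR (ltW r0)); rewrite ?nnegrE ?(le_trans _ lx) ?powR_ge0.
Qed.

Section Bridge.
Variable n : nat.
Implicit Types (A B M Q U X Y P : Mat) (u v : Vec).

Definition mx_of M : 'M[R[i]]_n := \matrix_(i, j) complex_of (M i j).
Definition cv_of v : 'cV[R[i]]_n := \col_i complex_of (v i).

Definition extend T (x : T) (f : 'I_n -> T) (i : nat) : T := oapp f x (insub i).
Definition Mat_of (X : 'M[R[i]]_n) : Mat :=
  fun i j => extend C0 (fun k => extend C0 (fun l => of_complex (X k l)) j) i.
Definition Vec_of (v : 'cV[R[i]]_n) : Vec := extend C0 (fun k => of_complex (v k 0)).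

Lemma extendE T (x : T) f (i : 'I_n) : extend x f i = f i.
Proof. by rewrite /extend valK. Qed.

Lemma Mat_ofK : cancel Mat_of mx_of.
Proof. by move=> X; apply/matrixP => i j; rewrite mxE /Mat_of !extendE of_complexK. Qed.

Lemma Vec_ofK : cancel Vec_of cv_of.
Proof. by move=> v; apply/colP => i; rewrite mxE /Vec_of extendE of_complexK. Qed.

Lemma meqE A B : meq n A B <-> mx_of A = mx_of B.
Proof.
split=> [AB|/matrixP AB i j /ssrnat.ltP ni /ssrnat.ltP nj].
  by apply/matrixP => i j; rewrite !mxE (AB i j) //; apply/ssrnat.ltP.
by apply: complex_of_inj; have := AB (Ordinal ni) (Ordinal nj); rewrite !mxE.
Qed.

Lemma mx_of_madd A B : mx_of (madd A B) = mx_of A + mx_of B.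
Proof. by apply/matrixP => i j; rewrite !mxE. Qed.

Lemma mx_of_msub A B : mx_of (msub A B) = mx_of A - mx_of B.
Proof. by apply/matrixP => i j; rewrite !mxE. Qed.

Lemma mx_of_mscale (r : R) A : mx_of (mscale r A) = r%:C *: mx_of A.
Proof. by apply/matrixP => i j; rewrite !mxE. Qed.

Lemma mx_of_mmul A B : mx_of (mmul n A B) = mx_of A *m mx_of B.
Proof.
by apply/matrixP => i j; rewrite !mxE complex_of_Csum; apply: eq_bigr => k _; rewrite !mxE.
Qed.

Lemma mx_of_madj A : mx_of (madj A) = (mx_of A)^t*.
Proof. by apply/matrixP => i j; rewrite !mxE. Qed.

Lemma mx_of_mdiag (d : nat -> R) : mx_of (mdiag d) = real_diag (fun i : 'I_n => d i).
Proof.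
apply/matrixP => i j; rewrite !mxE /mdiag -val_eqE /=.
by case: (Nat.eqb_spec i j) => [->|/eqP/negbTE ->]; rewrite ?eqxx ?mulr1n ?mulr0n.
Qed.

Lemma mx_of_mid : mx_of mid = 1%:M.
Proof. by rewrite (mx_of_mdiag (fun=> 1)); apply/matrixP => i j; rewrite !mxE. Qed.

Lemma cv_of_mvec A v : cv_of (mvec n A v) = mx_of A *m cv_of v.
Proof.
by apply/colP => i; rewrite !mxE complex_of_Csum; apply: eq_bigr => k _; rewrite !mxE.
Qed.

Lemma Re_inner u v : Defs.Re (inner n u v) = frodot (cv_of u) (cv_of v).
Proof.
rewrite -[LHS]/(complex.Re (complex_of _)) complex_of_Csum raddf_sum frodotE.
by apply: eq_bigr => k _; rewrite big_ord1 !mxE.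
Qed.

Lemma Re_inner_mvec A v : Defs.Re (inner n v (mvec n A v)) = qform (mx_of A) (cv_of v).
Proof. by rewrite Re_inner (cv_of_mvec A). Qed.

Lemma vnormE v : vnorm n v = fronorm (cv_of v).
Proof. by rewrite /vnorm Re_inner RsqrtE fronorm.unlock. Qed.

Lemma vnonzeroE v : vnonzero n v <-> cv_of v != 0.
Proof.
split=> [[i [/ssrnat.ltP ni vi]]|v0].
  apply/eqP => /colP/(_ (Ordinal ni)); rewrite !mxE /= => v0.
  by apply/vi/complex_of_inj.
have /cV0Pn[i vi] := v0; exists i; split; first exact/ssrnat.ltP.
by move=> v00; move: vi; rewrite mxE v00 eqxx.
Qed.

Lemma hermitianE A : Defs.hermitian n A <-> mx_of A \is hermsymmx.
Proof. by rewrite /Defs.hermitian meqE mx_of_madj; split=> /hermsymmxP. Qed.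

Lemma mleE P Q : mle n P Q <->
  [/\ mx_of P \is hermsymmx, mx_of Q \is hermsymmx & loewner_le (mx_of P) (mx_of Q)].
Proof.
rewrite /mle /psd !hermitianE; split=> [[hP [hQ [_ PQ]]]|[hP hQ PQ]].
  split=> // v; have := PQ (Vec_of v).
  by rewrite Re_inner_mvec Vec_ofK mx_of_msub qformB => /RleP; rewrite R0E subr_ge0.
split; [exact: hP | split; [exact: hQ | split]].
  by rewrite mx_of_msub; apply: hermsymmxB.
by move=> v; rewrite Re_inner_mvec mx_of_msub qformB; apply/RleP; rewrite R0E subr_ge0.
Qed.

Lemma pdE P : pd n P <-> posdefmx (mx_of P).
Proof.
rewrite /pd hermitianE posdefmxP; split=> -[hP P0]; split=> // v v0.
  have := P0 (Vec_of v); rewrite vnonzeroE Re_inner_mvec Vec_ofK => /(_ v0) /RltP.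
  by rewrite R0E.
by rewrite Re_inner_mvec; apply/RltP; rewrite R0E; apply/P0/vnonzeroE.
Qed.

Lemma unitaryE U : unitary n U <-> (mx_of U)^t* \is unitarymx.
Proof.
rewrite /unitary meqE mx_of_mmul mx_of_madj mx_of_mid -{2}[mx_of U]trmxCK.
by split=> /unitarymxP.
Qed.

Lemma mx_of_unitary_diag U (d : nat -> R) :
  mx_of (mmul n U (mmul n (mdiag d) (madj U))) =
  unidiag ((mx_of U)^t* ) (fun i : 'I_n => d i).
Proof. by rewrite !mx_of_mmul mx_of_madj mx_of_mdiag /unidiag trmxCK mulmxA. Qed.

Lemma mx_of_mpow Q (r : R) : posdefmx (mx_of Q) -> mx_of (mpow n Q r) = powmx (mx_of Q) r.
Proof.
move=> [hQ Q0]; set V := spectralmx (mx_of Q).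
have VV : V \is unitarymx by apply: spectral_unitarymx.
have QE : mx_of Q = unidiag V (eigval (mx_of Q)) by rewrite -{1}(fcalc_id hQ) fcalcE.
have [U [d [/unitaryE UU [d0 [/meqE Qd /meqE ->]]]]] : is_rpow n Q r (mpow n Q r).
  apply: (@epsilon_spec _ (inhabits mid) (fun Y => is_rpow n Q r Y)).
  exists (Mat_of (powmx (mx_of Q) r)), (Mat_of (V^t* )), (extend 1 (eigval (mx_of Q))).
  split; first by apply/unitaryE; rewrite Mat_ofK trmxCK.
  split=> [i /ssrnat.ltP ni|].
    by apply/RltP; rewrite R0E (extendE 1 _ (Ordinal ni)).
  split; apply/meqE; rewrite mx_of_unitary_diag !Mat_ofK trmxCK.
    by rewrite {1}QE; apply: eq_unidiag => i; rewrite extendE.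
  by rewrite powmxE fcalcE; apply: eq_unidiag => i; rewrite extendE RpowerE.
rewrite mx_of_unitary_diag in Qd; rewrite mx_of_unitary_diag Qd powmxE (fcalc_unidiag _ _ UU).
by apply: eq_unidiag => i; rewrite /= RpowerE //; apply/RltP/d0/ssrnat.ltP.
Qed.

Lemma mx_of_minv Q : posdefmx (mx_of Q) -> mx_of (minv n Q) = powmx (mx_of Q) (-1).
Proof.
move=> Q0; have QV : mx_of Q *m powmx (mx_of Q) (-1) = 1%:M.
  by rewrite -{1}(powmx1 Q0) (powmxD _ _ Q0) subrr powmx0.
have VQ := mulmx1C QV.
have [/meqE QQi _] : meq n (mmul n Q (minv n Q)) mid /\ meq n (mmul n (minv n Q) Q) mid.
  apply: (@epsilon_spec _ (inhabits mid) (fun B => meq n (mmul n Q B) mid /\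
    meq n (mmul n B Q) mid)); exists (Mat_of (powmx (mx_of Q) (-1))).
  by split; apply/meqE; rewrite mx_of_mmul Mat_ofK mx_of_mid.
by rewrite -[LHS]mul1mx -VQ -mulmxA -mx_of_mmul QQi mx_of_mid mulmx1.
Qed.

Lemma is_eigenvalueE M (l : R) : is_eigenvalue n M l <->
  exists2 v : 'cV_n, v != 0 & mx_of M *m v = l%:C *: v.
Proof.
split=> [[v [/vnonzeroE v0 Mv]]|[v v0 Mv]].
  exists (cv_of v) => //; rewrite -cv_of_mvec; apply/colP => i; rewrite !mxE Mv //.
  exact/ssrnat.ltP.
exists (Vec_of v); split; first by apply/vnonzeroE; rewrite Vec_ofK.
move=> i /ssrnat.ltP ni; apply: complex_of_inj.
by have /colP/(_ (Ordinal ni)) := Mv; rewrite -{1 2}[v]Vec_ofK -cv_of_mvec !mxE.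
Qed.

Lemma loewner_le_lambda1 M : mx_of M \is hermsymmx ->
  loewner_le (mx_of M) (lambda1 n M)%:C%:M.
Proof.
move=> hM; rewrite -{1}(fcalc_id hM) -(fcalc_cst _ (mx_of M)).
apply: loewner_le_fcalc => i.
have eig j : is_eigenvalue n M (eigval (mx_of M) j).
  apply/is_eigenvalueE; exists (eigvec (mx_of M) j); last exact: eigvecP.
  by rewrite -fronorm_eq0 fronorm_eigvec oner_eq0.
have [j _ jmax] := @Order.TotalTheory.arg_maxP _ R _ i predT (eigval (mx_of M)) isT.
have [|_ lmax] := @epsilon_spec _ (inhabits 0%R)
    (fun l => is_eigenvalue n M l /\ forall m, is_eigenvalue n M m -> Rle m l).
  exists (eigval (mx_of M) j); split=> // m /is_eigenvalueE[v v0 Mv]; apply/RleP.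
  have v1 : 0 < fronorm v ^+ 2 by rewrite exprn_gt0 ?fronorm_gt0.
  rewrite -(ler_pM2r v1) {1}sqr_fronorm -frodotZr -Mv -qform_scalar -/(qform _ v).
  rewrite -{1}(fcalc_id hM) -(fcalc_cst _ (mx_of M)).
  by apply: loewner_le_fcalc => l; apply: jmax.
by apply/RleP/lmax.
Qed.

(* The absolute value only matters in dimension 0, where [specnorm] is unspecified. *)
Lemma opnorm_le_specnorm A : opnorm_le (mx_of A) `|specnorm n A|.
Proof.
move=> v; have [->|v0] := eqVneq v 0; first by rewrite mulmx0 !fronorm0 mulr0.
pose ratio r := exists u : Vec, vnorm n u = 1%R /\ r = vnorm n (mvec n A u).
have ratio_v : ratio (fronorm (mx_of A *m v) / fronorm v).
  have w0 : 0 <= (fronorm v)^-1 by rewrite invr_ge0 fronorm_ge0.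
  exists (Vec_of ((fronorm v)^-1%:C *: v)); rewrite !vnormE cv_of_mvec Vec_ofK.
  rewrite -scalemxAr !fronormZ (ger0_norm w0) mulVf ?fronorm_eq0 //.
  by rewrite mulrC.
have [ub _] : is_lub ratio (specnorm n A).
  apply: (@epsilon_spec _ (inhabits (IZR 0)) (fun m => is_lub ratio m)).
  have [||m lub] := completeness ratio; [| by exists (fronorm (mx_of A *m v) / fronorm v) |].
    exists (fronorm (mx_of A)) => _ [u [u1 ->]]; apply/RleP.
    by rewrite vnormE cv_of_mvec (le_trans (opnorm_le_fronorm _ _)) // -vnormE u1 mulr1.
  by exists m.
rewrite -ler_pdivrMr ?fronorm_gt0 //; apply: le_trans (ler_norm _).
by apply/RleP/ub.
Qed.

Lemma mle_mscale_mid (l : R) P : mle n (mscale l mid) P <->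
  mx_of P \is hermsymmx /\ loewner_le l%:C%:M (mx_of P).
Proof.
rewrite mleE mx_of_mscale mx_of_mid scalemx1; split=> [[_ hP lP]|[hP lP]].
  by split.
split; [| exact: hP | exact: lP].
by rewrite -(fcalc_cst _ (mx_of P)) fcalc_herm.
Qed.

Lemma in_interval_mle P M X : in_interval n P M X -> mle n P M.
Proof.
move=> [_ [/mleE[hP _ PX] /mleE[_ hM XM]]]; apply/mleE.
by split; last exact: loewner_le_trans PX XM.
Qed.

Lemma in_intervalE (l r : R) Q X : posdefmx (mx_of Q) ->
  in_interval n (mscale l mid) (mpow n Q r) X <->
  [/\ mx_of X \is hermsymmx, loewner_le l%:C%:M (mx_of X) &
      loewner_le (mx_of X) (powmx (mx_of Q) r)].
Proof.
move=> Q0; split=> [[/hermitianE hX [/mle_mscale_mid[_ lX] /mleE[_ _]]]|[hX lX XQ]].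
  by rewrite (mx_of_mpow r Q0).
split; first exact/hermitianE.
split; first exact/mle_mscale_mid.
by apply/mleE; rewrite (mx_of_mpow r Q0); split=> //; apply: powmx_herm.
Qed.

Lemma loewner_le_conj_minv M Q (r x : R) : posdefmx (mx_of Q) -> 0 < r ->
  Rpower (lambda1 n (mmul n M (mmul n (minv n Q) (madj M)))) (1 / r) <= x ->
  loewner_le (mx_of M *m powmx (mx_of Q) (-1) *m (mx_of M)^t* ) (x `^ r)%:C%:M.
Proof.
move=> Q0 r0 lx; set N := mmul n M (mmul n (minv n Q) (madj M)).
have NE : mx_of N = mx_of M *m powmx (mx_of Q) (-1) *m (mx_of M)^t*.
  by rewrite !mx_of_mmul mx_of_madj mx_of_minv // mulmxA.
have hN : mx_of N \is hermsymmx.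
  by rewrite NE -{1}[mx_of M]trmxCK; apply/hermsymmx_conj/powmx_herm.
rewrite -NE; apply: loewner_le_trans (loewner_le_lambda1 hN) _ => v.
by rewrite !qform_scalar ler_wpM2r ?sqr_ge0 // le_powR_of_Rpower.
Qed.

Section Equation.
Variables (s t p : R) (A B Q : Mat).
Hypotheses (s1 : 1 <= s) (t1 : 1 <= t) (p1 : 1 <= p) (Q0 : posdefmx (mx_of Q)).

Let coef (j : bool) := mx_of (if j then A else B).
Let expo (j : bool) := if j then t else p.

Lemma is_solutionE X : posdefmx (mx_of X) ->
  is_solution n s t p A B Q X <-> eqn_solution coef expo (mx_of Q) s (mx_of X).
Proof.
move=> X0; rewrite /is_solution meqE !mx_of_madd !mx_of_mmul !mx_of_madj !(mx_of_mpow _ X0).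
by rewrite /eqn_solution /negpow_sum big_bool !mulmxA.
Qed.

Lemma eqn_floor_of_lambda1 (k c : R) : 0 < k -> 0 < c ->
  Rpower (lambda1 n (mmul n A (mmul n (minv n Q) (madj A)))) (1 / t) <= c ->
  Rpower (lambda1 n (mmul n B (mmul n (minv n Q) (madj B)))) (1 / p) <= c ->
  Rpower k (- t) + Rpower k (- p) < 1 ->
  lambda1 n (mscale (Rpower c s) (minv n Q)) <=
    (1 - Rpower k (- t) - Rpower k (- p)) * Rpower k (- s) ->
  eqn_floor coef expo (mx_of Q) s (k * c).
Proof.
move=> k0 c0; rewrite !(RpowerE _ k0) !(RpowerE _ c0) => lA lB sumk lQ.
apply: eqn_floor_scaled => // [|[]|].
- by rewrite big_bool.
- exact: loewner_le_conj_minv (lt_le_trans ltr01 t1) lA.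
- exact: loewner_le_conj_minv (lt_le_trans ltr01 p1) lB.
have QiE : mx_of (mscale (c `^ s) (minv n Q)) = (c `^ s)%:C *: powmx (mx_of Q) (-1).
  by rewrite mx_of_mscale mx_of_minv.
have hQi : mx_of (mscale (c `^ s) (minv n Q)) \is hermsymmx.
  by rewrite QiE; apply/hermsymmxZ/powmx_herm.
rewrite -QiE; apply: loewner_le_trans (loewner_le_lambda1 hQi) _ => v.
by rewrite !qform_scalar ler_wpM2r ?sqr_ge0 // big_bool opprD addrA.
Qed.

Variable c : R.
Hypotheses (c0 : 0 < c) (floorQ : eqn_floor coef expo (mx_of Q) s c).

Let expo_ge0 j : 0 <= expo j.
Proof. by case: j; apply: le_trans ler01 _. Qed.

Let hQ : mx_of Q \is hermsymmx. Proof. by have [] := Q0. Qed.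

Lemma interval_solution_ex : exists X,
  [/\ pd n X, in_interval n (mscale c mid) (mpow n Q (1 / s)) X & is_solution n s t p A B Q X].
Proof.
have [XM] := eqn_solution_ex s1 expo_ge0 c0 hQ floorQ.
rewrite -(Mat_ofK XM); set X := Mat_of XM => -[hX cX XQ solX].
have X0 := posdefmx_ge hX c0 cX; exists X.
split; [exact/pdE | exact/(in_intervalE _ _ _ Q0) | exact/(is_solutionE X0)].
Qed.

Lemma interval_solution_uniq X Y :
  1 / s * Rpower c (1 - s) * (t / Rpower c (t + 1) * specnorm n A ^+ 2 +
                              p / Rpower c (p + 1) * specnorm n B ^+ 2) < 1 ->
  in_interval n (mscale c mid) (mpow n Q (1 / s)) X ->
  in_interval n (mscale c mid) (mpow n Q (1 / s)) Y ->
  is_solution n s t p A B Q X -> is_solution n s t p A B Q Y -> meq n X Y.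
Proof.
move=> rate1 /(in_intervalE _ _ _ Q0)[hX cX _] /(in_intervalE _ _ _ Q0)[hY cY _].
move=> /(is_solutionE (posdefmx_ge hX c0 cX)) solX /(is_solutionE (posdefmx_ge hY c0 cY)) solY.
pose a j := `|specnorm n (if j then A else B)|.
apply/meqE/(@eqn_solution_uniq _ _ _ _ _ _ _ _ s1 expo_ge0 c0 hQ floorQ a _ _ _ _
  _ hX hY cX cY solX solY) => [j|j|].
- exact: normr_ge0.
- exact: opnorm_le_specnorm.
rewrite /eqn_rate big_bool /= !real_normK ?num_real // -!opprD !powRN.
by move: rate1; rewrite !(RpowerE _ c0).
Qed.

End Equation.
End Bridge.

Open Scope R_scope.

Theorem mainTheorem10 (n : nat) (s t p : R) (A B Q : Mat) (k : R) :
  1 <= s -> 1 <= t -> 1 <= p ->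
  invertible n A -> invertible n B -> pd n Q ->
  let c1 := Rmax (Rpower (lambda1 n (mmul n A (mmul n (minv n Q) (madj A)))) (1 / t))
                 (Rpower (lambda1 n (mmul n B (mmul n (minv n Q) (madj B)))) (1 / p)) in
  0 < k ->
  Rpower k (- t) + Rpower k (- p) < 1 ->
  lambda1 n (mscale (Rpower c1 s) (minv n Q))
    <= (1 - Rpower k (- t) - Rpower k (- p)) * Rpower k (- s) ->
  mle n (mscale (k * c1) mid) (mpow n Q (1 / s)) /\
  exists X : Mat,
    pd n X /\ in_interval n (mscale (k * c1) mid) (mpow n Q (1 / s)) X /\
    is_solution n s t p A B Q X /\
    (1 / s * Rpower (k * c1) (1 - s) *
       (t / Rpower (k * c1) (t + 1) * (specnorm n A) ^ 2 +
        p / Rpower (k * c1) (p + 1) * (specnorm n B) ^ 2) < 1 ->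
     forall Y : Mat,
       in_interval n (mscale (k * c1) mid) (mpow n Q (1 / s)) Y ->
       is_solution n s t p A B Q Y -> meq n Y X).
Proof.
move=> /RleP s1 /RleP t1 /RleP p1 _ _ /pdE Q0 c1 /RltP k0 /RltP sumk /RleP lamQ.
have c10 : (0 < c1)%R by rewrite /c1 RmaxE lt_max Rpower_gt0.
have kc0 : (0 < k * c1)%R := mulr_gt0 k0 c10.
have := lexx c1; rewrite {1}/c1 RmaxE ge_max => /andP[lamA lamB].
have floorQ := eqn_floor_of_lambda1 t1 p1 Q0 k0 c10 lamA lamB sumk lamQ.
have [X [X0 intX solX]] := interval_solution_ex s1 t1 p1 Q0 kc0 floorQ.
split; first exact: in_interval_mle intX.
exists X; do 3![split=> //]; move=> /RltP; rewrite !RpowE => rate1 Y intY solY.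
exact: (interval_solution_uniq s1 t1 p1 Q0 kc0 floorQ rate1 intY intX solY solX).
Qed.
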